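(* For any finite-image permutation representation $\gamma:\pi\to\mathrm{GL}_N\mathbb Z$ (a homomorphism into the group of $N\times N$ permutation matrices) of the group $\pi$ of a torus knot $k$, the $\gamma$-twisted Alexander polynomial $\Delta_{k,\gamma}$ is, up to multiplication by $\pm t^i$, a product of cyclotomic polynomials.
   Context: Let $V=\mathbb Z^N$ (row vectors), a right $\mathbb Z[\pi]$-module via $\gamma$; $X$ is the knot exterior, $\tilde X$, $X'$ its universal and infinite cyclic covers, $\epsilon:\pi\to\langle t\rangle\cong\mathbb Z$ abelianization. $H_*(X';V)$ is the homology of $(\mathbb Z[t^{\pm1}]\otimes V)\otimes_{\mathbb Z[\pi]}C_*(\tilde X)$ with $(p\otimes v)\cdot g=pt^{\epsilon(g)}\otimes v\gamma(g)$. $\Delta_{k,\gamma}$ is the greatest common divisor of the maximal minors of a presentation matrix of the $\mathbb Z[t^{\pm1}]$-module $H_1(X';V)$, well defined up to multiplication by $\pm t^i$. *)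

(* Defs.v *)
From HB Require Import structures.
From mathcomp Require Import all_boot all_order all_algebra all_field.
From mathcomp Require Import generic_quotient.
From mathcomp Require Import all_classical all_reals all_analysis.
From mathcomp Require Import continuous_path ring lra.

Set Implicit Arguments.
Unset Strict Implicit.
Unset Printing Implicit Defensive.

Import Order.TTheory GRing.Theory Num.Theory.
Import numFieldNormedType.Exports.

Local Open Scope classical_set_scope.
Local Open Scope quotient_scope.
Local Open Scope ring_scope.

Lemma continuous_compo (X Y Z : topologicalType) (f : X -> Y) (g : Y -> Z) :
  continuous f -> continuous g -> continuous (fun x => g (f x)).
Proof. by move=> cf cg x; apply: (cvg_comp _ _ (cf x) (cg (f x))). Qed.

Lemma continuous_pair (X Y Z : topologicalType) (f : X -> Y) (g : X -> Z) :
  continuous f -> continuous g -> continuous (fun x => (f x, g x)).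
Proof. by move=> cf cg x; apply: cvg_pair; [exact: cf|exact: cg]. Qed.

Lemma fst_continuous (X Y : topologicalType) : continuous (@fst X Y).
Proof. by move=> z; exact: cvg_fst. Qed.

Lemma snd_continuous (X Y : topologicalType) : continuous (@snd X Y).
Proof. by move=> z; exact: cvg_snd. Qed.

Section UnitInterval.
Variable R : realType.

Definition unit_interval : Type := set_type [set x : R | 0 <= x <= 1].

HB.instance Definition _ :=
  Topological.copy unit_interval (set_type [set x : R | 0 <= x <= 1]).

Lemma clamp_subproof (x : R) :
  Num.max 0 (Num.min 1 x) \in [set x : R | 0 <= x <= 1].
Proof.
by rewrite inE /=; rewrite le_max lexx /= ge_max ler01 ge_min lexx.
Qed.

Definition clamp (x : R) : unit_interval :=
  exist (fun y : R => y \in [set z : R | 0 <= z <= 1]) _ (clamp_subproof x).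

Definition ui_val (s : unit_interval) : R := val s.

Lemma ui_valP s : 0 <= ui_val s <= 1.
Proof. by have := valP s; rewrite inE. Qed.

Lemma clampK s : clamp (ui_val s) = s.
Proof.
apply/val_inj => /=; have /andP[s0 s1] := ui_valP s.
by rewrite min_r // max_r.
Qed.

Lemma clampE x : 0 <= x <= 1 -> ui_val (clamp x) = x.
Proof. by move=> /andP[x0 x1]; rewrite /ui_val /= min_r // max_r. Qed.

Lemma ui_val_inj : injective ui_val.
Proof. exact: val_inj. Qed.

Lemma ui_val_continuous : continuous ui_val.
Proof. exact: initial_continuous. Qed.

Lemma clamp_continuous : continuous clamp.
Proof.
apply: continuous_comp_initial => x.
have -> : set_val \o clamp = (cst 0 : R -> R) \max ((cst 1 : R -> R) \min id).
  by apply/funext => y.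
apply: continuous_max; first exact: cst_continuous.
by apply: continuous_min; [exact: cst_continuous|].
Qed.

Lemma clamp01_neq : clamp 0 != clamp 1.
Proof.
apply/eqP => /(congr1 ui_val); rewrite !clampE ?lexx ?ler01 // => /eqP.
by rewrite eq_sym oner_eq0.
Qed.

HB.instance Definition _ :=
  isBiPointed.Build unit_interval clamp01_neq.

Lemma ui_zero : ui_val zero = 0.
Proof. by rewrite clampE // lexx ler01. Qed.

Lemma ui_one : ui_val one = 1.
Proof. by rewrite clampE // lexx ler01. Qed.

Lemma continuous_glue (Y T : topologicalType) (c : Y -> R) (a : R)
    (f g : Y -> T) :
  continuous c -> continuous f -> continuous g ->
  (forall y, c y = a -> f y = g y) ->
  continuous (fun y => if c y <= a then f y else g y).
Proof.
move=> cc cf cg fg y U.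
have nbf : nbhs (f y) U -> nbhs y (f @^-1` U) by exact: cf.
have nbg : nbhs (g y) U -> nbhs y (g @^-1` U) by exact: cg.
case: (ltgtP (c y) a) => [lt|gt|eq] nU; rewrite nbhs_filterE.
- have : nbhs y (c @^-1` [set x | x < a]).
    by apply: cc; apply: open_nbhs_nbhs; split => //; exact: open_lt.
  move/(filterI (nbf nU)); apply: filterS => z [/= Uz /ltW -> //].
- have : nbhs y (c @^-1` [set x | a < x]).
    by apply: cc; apply: open_nbhs_nbhs; split => //; exact: open_gt.
  move/(filterI (nbg nU)); apply: filterS => z [/= Uz]; rewrite ltNge.
  by move=> /negbTE ->.
- have nU' : nbhs (g y) U by rewrite -fg.
  have : nbhs y ((f @^-1` U) `&` (g @^-1` U)) by exact: filterI (nbf nU) (nbg nU').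
  by apply: filterS => z [/= Uz Vz]; case: ifP.
Qed.

Lemma continuous_affine (Y : topologicalType) (a b : R) (w : Y -> R) :
  continuous w -> continuous (fun y => a * w y + b).
Proof.
move=> cw y; apply: cvgD; last exact: cst_continuous.
by apply: cvgM; [exact: cst_continuous|exact: cw].
Qed.

Lemma continuous_maxr (Y : topologicalType) (f g : Y -> R) :
  continuous f -> continuous g -> continuous (fun y => Num.max (f y) (g y)).
Proof. by move=> cf cg; exact: (max_fun_continuous cf cg). Qed.

Lemma continuous_minr (Y : topologicalType) (f g : Y -> R) :
  continuous f -> continuous g -> continuous (fun y => Num.min (f y) (g y)).
Proof. by move=> cf cg; exact: (min_fun_continuous cf cg). Qed.

Lemma continuous_clamp (Y : topologicalType) (h : Y -> R) :
  continuous h -> continuous (fun y => clamp (h y)).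
Proof. by move=> ch; exact: (continuous_compo ch clamp_continuous). Qed.

End UnitInterval.

Section Homotopy.
Variables (R : realType) (T : topologicalType).
Local Notation I := (unit_interval R).

Definition homotopic (x y : T) (f g : {path I from x to y}) : Prop :=
  exists H : I * I -> T, [/\ continuous H,
    forall s, H (s, zero) = f s, forall s, H (s, one) = g s,
    forall t, H (zero, t) = x & forall t, H (one, t) = y].

Let val_continuous (Y : topologicalType) (w : Y -> I) :
  continuous w -> continuous (fun y => ui_val (w y)).
Proof. by move=> cw; exact: (continuous_compo cw (@ui_val_continuous R)). Qed.

Lemma homotopic_reparam (x y x' y' : T) (f : {path I from x to y})
    (phi psi : I -> I) (u v : {path I from x' to y'}) :
  continuous phi -> continuous psi ->
  phi zero = psi zero -> phi one = psi one ->
  u =1 f \o phi -> v =1 f \o psi -> homotopic u v.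
Proof.
move=> cphi cpsi e0 e1 uE vE.
pose h (z : I * I) : R := ui_val (phi z.1) + ui_val z.2 *
  (ui_val (psi z.1) - ui_val (phi z.1)).
have ch : continuous h.
  have cv (w : I -> I) : continuous w ->
      continuous (fun z : I * I => ui_val (w z.1)).
    by move=> cw; exact: (val_continuous (continuous_compo (@fst_continuous _ _) cw)).
  move=> z; apply: cvgD; first exact: cv.
  apply: cvgM; last by apply: cvgB; exact: cv.
  exact: (val_continuous (@snd_continuous _ _)).
exists (fun z => f (clamp (h z))); split.
- exact: (continuous_compo (continuous_clamp ch) (@cts_fun _ _ f)).
- by move=> s; rewrite /h /= ui_zero mul0r addr0 clampK uE.
- by move=> s; rewrite /h /= ui_one mul1r addrC subrK clampK vE.
- move=> t; rewrite /h /= e0 subrr mulr0 addr0 clampK -e0.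
  by rewrite -[LHS]/((f \o phi) zero) -uE path_zero.
- move=> t; rewrite /h /= e1 subrr mulr0 addr0 clampK -e1.
  by rewrite -[LHS]/((f \o phi) one) -uE path_one.
Qed.

Lemma homotopic_refl (x y : T) (f : {path I from x to y}) : homotopic f f.
Proof.
by apply: (@homotopic_reparam _ _ _ _ f id id) => // z; exact: cvg_id.
Qed.

Let lo_continuous : continuous (fun s : I => clamp (2 * ui_val s)).
Proof.
have := continuous_clamp (@continuous_affine _ _ 2 0 _ (@ui_val_continuous R)).
by under eq_fun do rewrite addr0.
Qed.

Let hi_continuous : continuous (fun s : I => clamp (2 * ui_val s - 1)).
Proof. exact: continuous_clamp (@continuous_affine _ _ 2 (-1) _ (@ui_val_continuous R)). Qed.

Let rev_continuous : continuous (fun s : I => clamp (1 - ui_val s)).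
Proof.
have := continuous_clamp (@continuous_affine _ _ (-1) 1 _ (@ui_val_continuous R)).
by under eq_fun do rewrite mulN1r addrC.
Qed.

Let two_half : 2 * 2^-1 = 1 :> R. Proof. by rewrite divff. Qed.

Let clamp0 : clamp 0 = zero :> I. Proof. by []. Qed.

Let clamp1 : clamp 1 = one :> I. Proof. by []. Qed.

Let zero_half : ui_val (zero : I) <= 2^-1.
Proof. by rewrite ui_zero invr_ge0. Qed.

Let one_half : (ui_val (one : I) <= 2^-1) = false.
Proof. by rewrite ui_one; apply/negbTE; rewrite -ltNge invf_lt1 ?ltr0n // ltr1n. Qed.

Lemma homotopic_sym (x y : T) (f g : {path I from x to y}) :
  homotopic f g -> homotopic g f.
Proof.
move=> [H [cH H0 H1 Hx Hy]].
exists (fun z => H (z.1, clamp (1 - ui_val z.2))); split => //=.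
- apply: (continuous_compo _ cH); apply: continuous_pair.
    exact: fst_continuous.
  exact: (continuous_compo (@snd_continuous _ _) rev_continuous).
- by move=> s; rewrite ui_zero subr0 -H1.
- by move=> s; rewrite ui_one subrr -H0.
Qed.

Lemma homotopic_trans (x y : T) (f g h : {path I from x to y}) :
  homotopic f g -> homotopic g h -> homotopic f h.
Proof.
move=> [H [cH H0 H1 Hx Hy]] [K [cK K0 K1 Kx Ky]].
exists (fun z => if ui_val z.2 <= 2^-1 then H (z.1, clamp (2 * ui_val z.2))
                 else K (z.1, clamp (2 * ui_val z.2 - 1))).
have cvp (w : I -> I) (L : I * I -> T) : continuous w -> continuous L ->
    continuous (fun z : I * I => L (z.1, w z.2)).
  move=> cw cL; apply: (continuous_compo _ cL); apply: continuous_pair.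
    exact: fst_continuous.
  exact: (continuous_compo (@snd_continuous _ _) cw).
split => /=.
- apply: (@continuous_glue _ _ _ (fun z : I * I => ui_val z.2)).
  + exact: (val_continuous (@snd_continuous _ _)).
  + exact: (cvp _ _ lo_continuous cH).
  + exact: (cvp _ _ hi_continuous cK).
  + by move=> [s t] /= ->; rewrite two_half subrr clamp0 clamp1 H1 K0.
- by move=> s; rewrite zero_half ui_zero mulr0 -H0.
- by move=> s; rewrite one_half ui_one mulr1 addrK -K1.
- by move=> t; case: ifP.
- by move=> t; case: ifP.
Qed.

Section Concat.
Variables (x y z : T) (f : {path I from x to y}) (g : {path I from y to z}).

Definition concat_fun (s : I) : T :=
  if ui_val s <= 2^-1 then f (clamp (2 * ui_val s))
  else g (clamp (2 * ui_val s - 1)).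

Lemma concat_continuous : continuous concat_fun.
Proof.
apply: continuous_glue; first exact: ui_val_continuous.
- exact: (continuous_compo lo_continuous (@cts_fun _ _ f)).
- exact: (continuous_compo hi_continuous (@cts_fun _ _ g)).
- by move=> s ->; rewrite two_half subrr clamp0 clamp1 path_zero path_one.
Qed.

Lemma concat_zero : concat_fun zero = x.
Proof. by rewrite /concat_fun zero_half ui_zero mulr0 clamp0 path_zero. Qed.

Lemma concat_one : concat_fun one = z.
Proof. by rewrite /concat_fun one_half ui_one mulr1 addrK clamp1 path_one. Qed.

Definition concat : {path I from x to z} :=
  mk_path concat_continuous concat_zero concat_one.

End Concat.

Section Reverse.
Variables (x y : T) (f : {path I from x to y}).

Definition reverse_fun (s : I) : T := f (clamp (1 - ui_val s)).

Lemma reverse_continuous : continuous reverse_fun.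
Proof. exact: (continuous_compo rev_continuous (@cts_fun _ _ f)). Qed.

Lemma reverse_zero : reverse_fun zero = y.
Proof. by rewrite /reverse_fun ui_zero subr0 clamp1 path_one. Qed.

Lemma reverse_one : reverse_fun one = x.
Proof. by rewrite /reverse_fun ui_one subrr clamp0 path_zero. Qed.

Definition reverse : {path I from y to x} :=
  mk_path reverse_continuous reverse_zero reverse_one.

End Reverse.

Lemma concat_homotopic (x y z : T) (f f' : {path I from x to y})
    (g g' : {path I from y to z}) :
  homotopic f f' -> homotopic g g' -> homotopic (concat f g) (concat f' g').
Proof.
move=> [H [cH H0 H1 Hx Hy]] [K [cK K0 K1 Kx Ky]].
exists (fun z => if ui_val z.1 <= 2^-1 then H (clamp (2 * ui_val z.1), z.2)
                 else K (clamp (2 * ui_val z.1 - 1), z.2)).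
have cvp (w : I -> I) (L : I * I -> T) : continuous w -> continuous L ->
    continuous (fun z : I * I => L (w z.1, z.2)).
  move=> cw cL; apply: (continuous_compo _ cL); apply: continuous_pair.
    exact: (continuous_compo (@fst_continuous _ _) cw).
  exact: snd_continuous.
split => /=.
- apply: (@continuous_glue _ _ _ (fun z : I * I => ui_val z.1)).
  + exact: (val_continuous (@fst_continuous _ _)).
  + exact: (cvp _ _ lo_continuous cH).
  + exact: (cvp _ _ hi_continuous cK).
  + by move=> [s t] /= ->; rewrite two_half subrr clamp0 clamp1 Hy Kx.
- by move=> s; rewrite /mk_path /concat_fun H0 K0.
- by move=> s; rewrite /mk_path /concat_fun H1 K1.
- by move=> t; rewrite zero_half ui_zero mulr0 clamp0 Hx.
- by move=> t; rewrite one_half ui_one mulr1 addrK clamp1 Ky.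
Qed.

Lemma reverse_homotopic (x y : T) (f f' : {path I from x to y}) :
  homotopic f f' -> homotopic (reverse f) (reverse f').
Proof.
move=> [H [cH H0 H1 Hx Hy]].
exists (fun z => H (clamp (1 - ui_val z.1), z.2)); split => /=.
- apply: (continuous_compo _ cH); apply: continuous_pair.
    exact: (continuous_compo (@fst_continuous _ _) rev_continuous).
  exact: snd_continuous.
- by move=> s; rewrite /mk_path /reverse_fun H0.
- by move=> s; rewrite /mk_path /reverse_fun H1.
- by move=> t; rewrite ui_zero subr0 clamp1 Hy.
- by move=> t; rewrite ui_one subrr clamp0 Hx.
Qed.


Lemma concatA_homotopic (x y z w : T) (f : {path I from x to y})
    (g : {path I from y to z}) (h : {path I from z to w}) :
  homotopic (concat f (concat g h)) (concat (concat f g) h).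
Proof.
pose phi (s : I) : I := clamp (Num.max (2^-1 * ui_val s + 0)
  (Num.max (1 * ui_val s + - 4^-1) (2 * ui_val s + - 1))).
have ca (a b : R) : continuous (fun s : I => a * ui_val s + b).
  exact: (@continuous_affine _ _ a b _ (@ui_val_continuous R)).
have cphi : continuous phi.
  apply: continuous_clamp.
  exact: (continuous_maxr (ca _ _) (continuous_maxr (ca _ _) (ca _ _))).
have phiE s : ui_val (phi s) = if ui_val s <= 2^-1 then ui_val s / 2 else
    if ui_val s <= 3 / 4 then ui_val s - 4^-1 else 2 * ui_val s - 1.
  have /andP[s0 s1] := ui_valP s; rewrite /phi.
  have [s2|s2] := lerP (ui_val s) 2^-1.
    by rewrite max_l ?ge_max ?clampE; lra.
  have [s4|s4] := lerP (ui_val s) (3 / 4).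
    by rewrite [X in Num.max _ X]max_l ?max_r ?clampE; lra.
  by rewrite [X in Num.max _ X]max_r ?max_r ?clampE; lra.
apply: (@homotopic_reparam _ _ _ _ (concat (concat f g) h) phi id) => //.
- by move=> s; exact: cvg_id.
- by apply: ui_val_inj; rewrite phiE ui_zero; do ?[case: lerP => ?]; lra.
- by apply: ui_val_inj; rewrite phiE ui_one; do ?[case: lerP => ?]; lra.
move=> s /=; have /andP[s0 s1] := ui_valP s.
rewrite /mk_path /concat_fun /= /mk_path /concat_fun phiE.
have [s2|s2] := lerP (ui_val s) 2^-1.
  rewrite !ifT; [|rewrite ?clampE; lra..].
  by congr (f (clamp _)); rewrite clampE; lra.
have [s4|s4] := lerP (ui_val s) (3 / 4).
  rewrite ifT; last by rewrite clampE; lra.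
  rewrite ifT; last by lra.
  rewrite ifF; last by apply/negbTE; rewrite -ltNge clampE; lra.
  by congr (g (clamp _)); rewrite !clampE; lra.
rewrite ifF; last by apply/negbTE; rewrite -ltNge clampE; lra.
rewrite ifF; last by apply/negbTE; rewrite -ltNge; lra.
by congr (h (clamp _)); rewrite !clampE; lra.
Qed.

Lemma concat1f_homotopic (x y : T) (f : {path I from x to y}) :
  homotopic (concat (cst x : {path I from x to x}) f) f.
Proof.
apply: (homotopic_reparam (f := f) hi_continuous (psi := id)) => //.
- by move=> s; exact: cvg_id.
- by apply: ui_val_inj; rewrite ui_zero /ui_val /= mulr0 sub0r min_r ?max_l; lra.
- by rewrite ui_one mulr1 addrK.
- move=> s /=; rewrite /mk_path /concat_fun; case: ifP => // s2.
  have -> : clamp (2 * ui_val s - 1) = zero; last by rewrite path_zero.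
  by apply: ui_val_inj; rewrite ui_zero {1}/ui_val /= min_r ?max_l; lra.
Qed.

Lemma concatf1_homotopic (x y : T) (f : {path I from x to y}) :
  homotopic (concat f (cst y : {path I from y to y})) f.
Proof.
apply: (homotopic_reparam (f := f) lo_continuous (psi := id)) => //.
- by move=> s; exact: cvg_id.
- by rewrite ui_zero mulr0.
- by apply: ui_val_inj; rewrite ui_one /ui_val /= min_l ?max_r; lra.
- move=> s /=; rewrite /mk_path /concat_fun; case: (lerP (ui_val s)) => // s2.
  have -> : clamp (2 * ui_val s) = one; last by rewrite path_one.
  by apply: ui_val_inj; rewrite ui_one {1}/ui_val /= min_l ?max_r; lra.
Qed.

Lemma concatfV_homotopic (x y : T) (f : {path I from x to y}) :
  homotopic (concat f (reverse f)) (cst x : {path I from x to x}).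
Proof.
pose phi (s : I) : I := clamp (Num.min (2 * ui_val s + 0) (- 2 * ui_val s + 2)).
have ca (a b : R) : continuous (fun s : I => a * ui_val s + b).
  exact: (@continuous_affine _ _ a b _ (@ui_val_continuous R)).
have cphi : continuous phi.
  by apply: continuous_clamp; exact: (continuous_minr (ca _ _) (ca _ _)).
have phi0 : phi zero = zero.
  by apply: ui_val_inj; rewrite /phi ui_zero min_l ?clampE; lra.
have phi1 : phi one = zero.
  by apply: ui_val_inj; rewrite /phi ui_one ui_zero min_r ?clampE; lra.
apply: (homotopic_reparam (f := f) cphi (psi := cst zero)) => //.
- exact: cst_continuous.
- move=> s /=; have /andP[s0 s1] := ui_valP s.
  rewrite /mk_path /concat_fun /= /mk_path /reverse_fun /phi.
  have [s2|s2] := lerP (ui_val s) 2^-1.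
    by congr (f (clamp _)); rewrite min_l; lra.
  by congr (f (clamp _)); rewrite min_r ?clampE; lra.
- by move=> s /=; rewrite path_zero.
Qed.

Lemma concatVf_homotopic (x y : T) (f : {path I from x to y}) :
  homotopic (concat (reverse f) f) (cst y : {path I from y to y}).
Proof.
pose phi (s : I) : I := clamp (Num.max (- 2 * ui_val s + 1) (2 * ui_val s - 1)).
have ca (a b : R) : continuous (fun s : I => a * ui_val s + b).
  exact: (@continuous_affine _ _ a b _ (@ui_val_continuous R)).
have cphi : continuous phi.
  by apply: continuous_clamp; exact: (continuous_maxr (ca _ _) (ca _ _)).
have phi0 : phi zero = one.
  by apply: ui_val_inj; rewrite /phi ui_zero ui_one max_l ?clampE; lra.
have phi1 : phi one = one.
  by apply: ui_val_inj; rewrite /phi ui_one max_r ?clampE; lra.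
apply: (homotopic_reparam (f := f) cphi (psi := cst one)) => //.
- exact: cst_continuous.
- move=> s /=; have /andP[s0 s1] := ui_valP s.
  rewrite /mk_path /concat_fun /= /mk_path /reverse_fun /phi.
  have [s2|s2] := lerP (ui_val s) 2^-1.
    by congr (f (clamp _)); rewrite max_l ?clampE; lra.
  by congr (f (clamp _)); rewrite max_r; lra.
- by move=> s /=; rewrite path_one.
Qed.

Section FundamentalGroup.
Variable x : T.
Local Notation loop := {path I from x to x}.

Definition loop_homotopic : rel loop := fun f g => `[< homotopic f g >].

Lemma loop_homotopic_refl : reflexive loop_homotopic.
Proof. by move=> f; apply/asboolP; exact: homotopic_refl. Qed.

Lemma loop_homotopic_sym : ssrbool.symmetric loop_homotopic.
Proof. by move=> f g; apply/asboolP/asboolP; exact: homotopic_sym. Qed.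

Lemma loop_homotopic_trans : ssrbool.transitive loop_homotopic.
Proof.
by move=> g f h /asboolP fg /asboolP gh; apply/asboolP; exact: homotopic_trans gh.
Qed.

Canonical loop_homotopic_equiv := EquivRel loop_homotopic
  loop_homotopic_refl loop_homotopic_sym loop_homotopic_trans.

Definition pi1 : Type := {eq_quot loop_homotopic}.

HB.instance Definition _ := Choice.on pi1.
HB.instance Definition _ := EqQuotient.on pi1.

Definition loop_class (f : loop) : pi1 := \pi_pi1 f.

Lemma loop_classP f g : loop_class f = loop_class g <-> homotopic f g.
Proof.
rewrite /loop_class; split => [/eqquotP /asboolP //|fg].
by apply/eqquotP/asboolP.
Qed.

Lemma loop_class_repr (a : pi1) : loop_class (repr a) = a.
Proof. exact: reprK. Qed.

Lemma repr_loop_class f : homotopic (repr (loop_class f)) f.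
Proof. by apply/loop_classP; rewrite loop_class_repr. Qed.

Definition pi1_one : pi1 := loop_class (cst x).
Definition pi1_mul (a b : pi1) : pi1 := loop_class (concat (repr a) (repr b)).
Definition pi1_inv (a : pi1) : pi1 := loop_class (reverse (repr a)).

Lemma pi1_mulE f g :
  pi1_mul (loop_class f) (loop_class g) = loop_class (concat f g).
Proof.
by apply/loop_classP; apply: concat_homotopic; exact: repr_loop_class.
Qed.

Lemma pi1_invE f : pi1_inv (loop_class f) = loop_class (reverse f).
Proof. by apply/loop_classP; apply: reverse_homotopic; exact: repr_loop_class. Qed.

Lemma pi1_mulA : associative pi1_mul.
Proof.
move=> a b c; rewrite -[a]loop_class_repr -[b]loop_class_repr.
rewrite -[c]loop_class_repr !pi1_mulE.
by apply/loop_classP; exact: concatA_homotopic.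
Qed.

Lemma pi1_mul1g : left_id pi1_one pi1_mul.
Proof.
move=> a; rewrite -[a]loop_class_repr pi1_mulE.
by apply/loop_classP; exact: concat1f_homotopic.
Qed.

Lemma pi1_mulg1 : right_id pi1_one pi1_mul.
Proof.
move=> a; rewrite -[a]loop_class_repr pi1_mulE.
by apply/loop_classP; exact: concatf1_homotopic.
Qed.

Lemma pi1_mulVg : left_inverse pi1_one pi1_inv pi1_mul.
Proof.
move=> a; rewrite -[a]loop_class_repr pi1_invE pi1_mulE.
by apply/loop_classP; exact: concatVf_homotopic.
Qed.

Lemma pi1_mulgV : right_inverse pi1_one pi1_inv pi1_mul.
Proof.
move=> a; rewrite -[a]loop_class_repr pi1_invE pi1_mulE.
by apply/loop_classP; exact: concatfV_homotopic.
Qed.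

HB.instance Definition _ := isGroup.Build pi1
  pi1_mulA pi1_mul1g pi1_mulg1 pi1_mulVg pi1_mulgV.

End FundamentalGroup.

End Homotopy.

Section CoveringSpaces.
Variable R : realType.
Local Notation I := (unit_interval R).

Definition homeomorphism (X Y : topologicalType) (f : X -> Y) : Prop :=
  continuous f /\ exists g : Y -> X, [/\ continuous g, cancel f g & cancel g f].

(* On each sheet V, the map s is the inverse of the restriction of p. *)
Definition evenly_covered (E X : topologicalType) (p : E -> X) (U : set X) :=
  exists sheets : set (set E),
    [/\ forall V, sheets V -> open V,
        forall V W, sheets V -> sheets W -> V `&` W !=set0 -> V = W,
        p @^-1` U = \bigcup_(V in sheets) V &
        forall V, sheets V -> exists s : X -> E,
          [/\ {within U, continuous s},
              forall x, U x -> V (s x) /\ p (s x) = x &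
              forall e, V e -> s (p e) = e]].

Definition covering_map (E X : topologicalType) (p : E -> X) : Prop :=
  [/\ continuous p, forall x, exists e, p e = x &
      forall x, exists U, [/\ open U, U x & evenly_covered p U]].

Definition simply_connected (E : topologicalType) : Prop :=
  [/\ inhabited E,
      forall x y : E, inhabited {path I from x to y} &
      forall (x : E) (f : {path I from x to x}),
        homotopic f (cst x : {path I from x to x})].

Definition universal_cover (E X : topologicalType) (p : E -> X) : Prop :=
  covering_map p /\ simply_connected E.

Definition deck_transformation (E X : topologicalType) (p : E -> X)
    (D : E -> E) : Prop :=
  homeomorphism D /\ p \o D =1 p.

(* The identification of the fundamental group with the group of deck
   transformations that is determined by the base point e0: the class of a loop
   f acts as the deck transformation that moves e0 to the endpoint of the lift
   of f starting at e0.  As f is traversed first in concat f g, this is a left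
   action. *)
Definition deck_of (E X : topologicalType) (p : E -> X) (e0 : E)
    (g : pi1 R (p e0)) (D : E -> E) : Prop :=
  deck_transformation p D /\
  exists (f : {path I from p e0 to p e0}) (q : {path I from e0 to D e0}),
    p \o q =1 f /\ loop_class f = g.

End CoveringSpaces.

Inductive commutator_subgroup (G : groupType) : set G :=
  | CommutatorSubgroup_one : commutator_subgroup 1%g
  | CommutatorSubgroup_comm x y : commutator_subgroup [~ x, y]%g
  | CommutatorSubgroup_mul x y : commutator_subgroup x ->
      commutator_subgroup y -> commutator_subgroup (x * y)%g
  | CommutatorSubgroup_inv x : commutator_subgroup x ->
      commutator_subgroup x^-1%g.

Definition abelianization_int (G : groupType) (eps : G -> int) : Prop :=
  [/\ forall x y, eps (x * y)%g = eps x + eps y,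
      forall z, exists x, eps x = z &
      forall x, eps x = 0 <-> commutator_subgroup x].

(* The image of gamma is finite, since there are N! permutation matrices. *)
Definition permutation_representation (G : groupType) (N : nat)
    (gamma : G -> 'M[int]_N) : Prop :=
  [/\ gamma 1%g = 1%:M,
      forall x y, gamma (x * y)%g = gamma x *m gamma y &
      forall x, is_perm_mx (gamma x)].

Section TorusKnots.
Variable R : realType.

(* The plane R * R stands for the complex numbers. *)
Definition sqnorm (z : R * R) : R := z.1 ^+ 2 + z.2 ^+ 2.

Definition sphere1 : Type := set_type [set z : R * R | sqnorm z = 1].
HB.instance Definition _ :=
  Topological.copy sphere1 (set_type [set z : R * R | sqnorm z = 1]).

Definition sphere3 : Type :=
  set_type [set x : (R * R) * (R * R) | sqnorm x.1 + sqnorm x.2 = 1].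
HB.instance Definition _ := Topological.copy sphere3
  (set_type [set x : (R * R) * (R * R) | sqnorm x.1 + sqnorm x.2 = 1]).

Definition cis (r a : R) : R * R := (r * cos a, r * sin a).

Definition standard_torus_knot (p q : nat) : set sphere3 :=
  [set x | exists a : R, set_val x =
    (cis (Num.sqrt 2)^-1 (p%:R * a), cis (Num.sqrt 2)^-1 (q%:R * a))].

(* Homeomorphisms may reverse the orientation, so that the torus knots with
   a negative parameter, which are the mirror images, are included. *)
Definition torus_knot (k : set sphere3) : Prop :=
  exists p q : nat, [/\ (0 < p)%N, (0 < q)%N, coprime p q &
    exists h : sphere3 -> sphere3,
      homeomorphism h /\ k = h @` standard_torus_knot p q].

(* tau embeds a whole open bundle of planes, and exterior removes only the unit
   disc bundle, so that the boundary torus of the exterior is bicollared. *)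
Definition tubular_neighbourhood (k : set sphere3)
    (tau : sphere1 * (R * R) -> sphere3) : Prop :=
  [/\ continuous tau, injective tau,
      forall O, open O -> open (tau @` O) &
      tau @` [set y | y.2 = (0, 0)] = k].

Definition exterior (tau : sphere1 * (R * R) -> sphere3) : set sphere3 :=
  ~` (tau @` [set y | sqnorm y.2 < 1]).

End TorusKnots.

Section Laurent.

Definition laurent_pred : {pred {fraction {poly int}}} :=
  fun x => `[< exists (n : nat) (q : {poly int}),
                 x * tofrac 'X ^+ n = tofrac q >].

Lemma laurent_subring_closed : subring_closed laurent_pred.
Proof.
split.
- by apply/asboolP; exists 0%N, 1; rewrite mulr1 rmorph1.
- move=> x y /asboolP[n [q xE]] /asboolP[m [r yE]]; apply/asboolP.
  exists (n + m)%N, (q * 'X^m - r * 'X^n).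
  rewrite rmorphB !rmorphM !rmorphXn /= -xE -yE exprD; ring.
- move=> x y /asboolP[n [q xE]] /asboolP[m [r yE]]; apply/asboolP.
  exists (n + m)%N, (q * r).
  by rewrite rmorphM /= -xE -yE exprD; ring.
Qed.

HB.instance Definition _ :=
  GRing.isSubringClosed.Build _ laurent_pred laurent_subring_closed.

(* The ring of integral Laurent polynomials, inside the field of fractions of
   the polynomial ring. *)
Record laurent := Laurent {
  laurent_val :> {fraction {poly int}};
  _ : laurent_val \in laurent_pred }.

HB.instance Definition _ := [isSub for laurent_val].
HB.instance Definition _ := [Choice of laurent by <:].
HB.instance Definition _ := [SubChoice_isSubComNzRing of laurent by <:].

Lemma laurent_tpow_subproof (z : int) : tofrac 'X ^ z \in laurent_pred.
Proof.
have X0 : tofrac 'X != 0 :> {fraction {poly int}}.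
  by rewrite tofrac_eq0 polyX_eq0.
apply/asboolP; case: z => n.
  by exists 0%N, 'X^n; rewrite mulr1 rmorphXn.
by exists n.+1, 1; rewrite NegzE -exprnN mulVf ?rmorph1 // expf_neq0.
Qed.

Definition tpow (z : int) : laurent := Laurent (laurent_tpow_subproof z).

Lemma laurent_of_poly_subproof (q : {poly int}) : tofrac q \in laurent_pred.
Proof. by apply/asboolP; exists 0%N, q; rewrite mulr1. Qed.

Definition laurent_of_poly (q : {poly int}) : laurent :=
  Laurent (laurent_of_poly_subproof q).

End Laurent.

Section Singular.
Variable R : realType.

Definition std_simplex (n : nat) : Type :=
  set_type [set x : 'rV[R]_n.+1 |
    (forall i, 0 <= x 0 i) /\ \sum_i x 0 i = 1].
HB.instance Definition _ (n : nat) := Topological.copy (std_simplex n)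
  (set_type [set x : 'rV[R]_n.+1 |
    (forall i, 0 <= x 0 i) /\ \sum_i x 0 i = 1]).

Definition insert_zero n (i : 'I_n.+2) (x : 'rV[R]_n.+1) : 'rV[R]_n.+2 :=
  \row_j (if unlift i j is Some k then x 0 k else 0).

Lemma insert_zero_subproof n (i : 'I_n.+2) (x : std_simplex n) :
  insert_zero i (set_val x) \in [set y : 'rV[R]_n.+2 |
    (forall i, 0 <= y 0 i) /\ \sum_i y 0 i = 1].
Proof.
have := valP x; rewrite !inE => -[x0 x1]; split => /=.
  by move=> j; rewrite mxE; case: unliftP.
rewrite (bigD1_ord i) //= mxE unlift_none add0r -[RHS]x1.
by apply: eq_bigr => j _; rewrite mxE liftK.
Qed.

Definition face_map n (i : 'I_n.+2) (x : std_simplex n) : std_simplex n.+1 :=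
  exist (fun y => y \in [set y : 'rV[R]_n.+2 |
    (forall i, 0 <= y 0 i) /\ \sum_i y 0 i = 1]) _ (insert_zero_subproof i x).

Lemma face_map_continuous n (i : 'I_n.+2) : continuous (face_map i).
Proof.
have cj j : continuous (fun y : std_simplex n => insert_zero i (set_val y) 0 j).
  have -> : (fun y : std_simplex n => insert_zero i (set_val y) 0 j) =
      (fun y => if unlift i j is Some k then (set_val y : 'rV[R]_n.+1) 0 k else 0).
    by apply/funext => y; rewrite mxE.
  case: unlift => [k|]; last exact: cst_continuous.
  apply: (@continuous_compo _ _ _ set_val (fun y : 'rV[R]_n.+1 => y 0 k)).
    exact: initial_continuous.
  exact: coord_continuous.
have near_face (x : std_simplex n) (P : 'I_n.+2 -> set R) :
    (forall j, nbhs (insert_zero i (set_val x) 0 j) (P j)) ->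
    nbhs x [set y : std_simplex n | forall j, P j (insert_zero i (set_val y) 0 j)].
  move=> nP; apply: (@filter_forall (std_simplex n) _ (fun j y =>
    P j (insert_zero i (set_val y) 0 j)) (nbhs x) (nbhs_filter x)) => j.
  exact: (cj j x _ (nP j)).
apply: continuous_comp_initial => x U [P nP sPU].
apply: (@filterS (std_simplex n) _ (nbhs_filter x) _ _ _
  (near_face x (P 0) (nP 0))) => y Py.
by apply: sPU => a j; rewrite (ord1 a); exact: Py.
Qed.

HB.instance Definition _ n (i : 'I_n.+2) :=
  isContinuous.Build _ _ (face_map i) (@face_map_continuous n i).

Definition singular_simplex (E : topologicalType) (n : nat) :=
  continuousType (std_simplex n) E.

Definition face (E : topologicalType) n (i : 'I_n.+2)
    (s : singular_simplex E n.+1) : singular_simplex E n := s \o face_map i.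

End Singular.

Section TwistedHomology.
Variables (R : realType) (E X : topologicalType) (p : E -> X) (e0 : E).
Variables (eps : pi1 R (p e0) -> int) (N : nat).
Variable gamma : pi1 R (p e0) -> 'M[int]_N.

(* The row vectors over the Laurent polynomials are the tensor product of the
   ring of Laurent polynomials with the group V of integral row vectors. *)
Local Notation W := 'rV[laurent]_N.

Definition right_action (w : W) (g : pi1 R (p e0)) : W :=
  tpow (eps g) *: (w *m map_mx intr (gamma g)).

(* A finitely supported function from simplices to W is an element of the
   tensor product over Z of W with the group of singular chains of E. *)
Definition chain (n : nat) : Type := singular_simplex R E n -> W.
HB.instance Definition _ n := GRing.Lmodule.on (chain n).

Definition finite_support n (c : chain n) : Prop :=
  finite_set [set s | c s != 0].

Definition pure_tensor n (w : W) (s : singular_simplex R E n) : chain n :=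
  fun s' => if s' == s then w else 0.

Definition differential n (c : chain n.+1) : chain n :=
  \sum_(s \in [set: singular_simplex R E n.+1])
    \sum_(i < n.+2) pure_tensor ((-1) ^+ i *: c s) (face i s).

(* The kernel of the projection onto the tensor product over the integral group
   ring of the fundamental group. *)
Inductive tensor_relation n : set (chain n) :=
  | TensorRelation_gen w g (D : continuousType E E)
      (s : singular_simplex R E n) : deck_of g D ->
      tensor_relation (pure_tensor (right_action w g) s -
                       pure_tensor w (D \o s : singular_simplex R E n))
  | TensorRelation_zero : tensor_relation 0
  | TensorRelation_add c d : tensor_relation c -> tensor_relation d ->
      tensor_relation (c + d)
  | TensorRelation_opp c : tensor_relation c -> tensor_relation (- c).

(* The cycles and the boundaries of the tensor product over the group ring,
   represented by chains modulo tensor_relation. *)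
Definition cycles n : set (chain n.+1) :=
  [set c | finite_support c /\ tensor_relation (differential c)].

Definition boundaries n : set (chain n) :=
  [set c | exists2 b : chain n.+1,
             finite_support b & tensor_relation (c - differential b)].

End TwistedHomology.

(* A is the matrix of relations, one in each row, between n generators of the
   quotient Z / B of submodules of C. *)
Definition presentation_matrix (L : comNzRingType) (C : lmodType L)
    (Z B : set C) (m n : nat) (A : 'M[L]_(m, n)) : Prop :=
  exists z : 'I_n -> C,
    [/\ forall j, Z (z j),
        forall c, Z c -> exists a : 'rV[L]_n, B (c - \sum_j a 0 j *: z j) &
        forall a : 'rV[L]_n, B (\sum_j a 0 j *: z j) <->
                             exists b : 'rV[L]_m, a = b *m A].

Definition is_gcd (L : comNzRingType) (I : Type) (F : I -> L) (d : L) : Prop :=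
  (forall i, exists c, F i = c * d) /\
  (forall d', (forall i, exists c, F i = c * d') -> exists c, d = c * d').

(* The maximal minors are those of order n; the choices of rows that are not
   injective contribute zeros, which do not affect the divisor. *)
Definition twisted_alexander_polynomial (R : realType) (E X : topologicalType)
    (p : E -> X) (e0 : E) (eps : pi1 R (p e0) -> int) (N : nat)
    (gamma : pi1 R (p e0) -> 'M[int]_N) (Delta : laurent) : Prop :=
  exists (m n : nat) (A : 'M[laurent]_(m, n)),
    presentation_matrix (@cycles R E X p e0 eps N gamma 0)
                        (@boundaries R E X p e0 eps N gamma 1) A /\
    is_gcd (fun f : {ffun 'I_n -> 'I_m} => \det (rowsub f A)) Delta.

(* Main.v *)
Require Import Defs.
From HB Require Import structures.
From mathcomp Require Import all_boot all_order all_algebra all_fingroup all_field.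
From mathcomp Require Import generic_quotient.
From mathcomp Require Import all_classical all_reals all_analysis.
From mathcomp Require Import continuous_path ring lra.

Set Implicit Arguments.
Unset Strict Implicit.
Unset Printing Implicit Defensive.

Import Order.TTheory GRing.Theory Num.Theory.
Import numFieldNormedType.Exports.

Local Open Scope classical_set_scope.
Local Open Scope ring_scope.

(** Let [M] be the homology module with twisted coefficients. It is enough that
    [t ^ m - 1] annihilates [M] for some [m <> 0]. Indeed [t ^ m - 1] times the
    identity matrix is then a product [B A], where [A] presents [M], and its
    determinant [(t ^ m - 1) ^ n] is a combination of the maximal minors of [A]
    ([gcd_minors_dvd_annihilator]). So [Delta] divides a power of a product of
    cyclotomic polynomials, which are prime in the ring of integral polynomials
    ([laurent_dvd_tpow_int_sub_1]).

    The annihilator comes from the action of the circle on the sphere, by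
    [(z, w) |-> (u ^ p z, u ^ q w)], which preserves the torus knot of type
    [(p, q)]. The tubular neighbourhood need not be invariant, but the complement
    of the knot retracts by deformation onto the exterior [X]; moving a point of
    [X] along its orbit and then retracting gives a homotopy [H] from the identity
    of [X] to itself ([exterior_action]). Let [g] be the class of the loop that
    [H] traces from the base point. The lift of [H] to the covering space starts
    at the identity and ends at the deck transformation of [g]; as it commutes
    with all deck transformations, its prism operator is a chain homotopy over the
    group ring from the identity to the action of [g]. On the coefficients, [g]
    acts as the power [t ^ eps g] times a permutation matrix, so that some power
    of [g] acts as a power [t ^ m] with [m] a positive multiple of [eps g], and
    [t ^ m - 1] annihilates [M] ([identity_homotopy_annihilates]).

    It remains that [eps g <> 0], that is, that [g] is not in the commutator
    subgroup ([orbit_not_commutator]). The function [z ^ q - w ^ p], suitably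
    rescaled, vanishes on the sphere exactly at the knot, and the action multiplies
    it by [u ^ (p q)]. Its argument therefore turns [p q] times along an orbit,
    whereas the winding number is a homomorphism from the fundamental group to the
    reals and vanishes on commutators. The winding numbers and the lift of [H] rest
    on the same lifting theorem ([homotopy_lifting]), applied to the covering of
    the circle by the line and to the given covering. *)

(** * Divisors of products of cyclotomic polynomials *)

(** The relation [%|] on integral polynomials is divisibility over the rational
    numbers; this one is divisibility in the ring itself. *)
Definition poly_dvd (d a : {poly int}) : Prop := exists r, a = r * d.

Definition poly_prime (d : {poly int}) : Prop :=
  d != 0 /\ forall a b, poly_dvd d (a * b) -> poly_dvd d a \/ poly_dvd d b.

Lemma poly_prime_X : poly_prime 'X.
Proof.
split=> [|a b [r]]; first by rewrite polyX_eq0.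
have rootX c : c.[0] = 0 -> poly_dvd 'X c.
  move/eqP=> /factor_theorem[q ->]; exists q.
  by rewrite subr0.
move/(congr1 (fun u => u.[0])); rewrite hornerM hornerMX mulr0.
by move/eqP; rewrite mulf_eq0 => /orP[]/eqP/rootX; [left|right].
Qed.

(** The remainder of [a] modulo ['Phi_n] vanishes at a primitive root of unity
    and has degree less than that of the minimal polynomial. *)
Lemma Cyclotomic_dvdP n (z : algC) (a : {poly int}) :
  n.-primitive_root z ->
  root (map_poly intr a) z -> poly_dvd 'Phi_n a.
Proof.
move=> zn az; have Dz := Cintr_Cyclotomic zn.
have mPhi := Cyclotomic_monic n.
have aE := Pdiv.RingMonic.rdivp_eq mPhi a.
set q := Pdiv.Ring.rdivp _ _ in aE; set r := Pdiv.Ring.rmodp _ _ in aE.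
have sr : (size r < size 'Phi_n)%N.
  by rewrite Pdiv.Ring.ltn_rmodp monic_neq0.
have Phiz : root (map_poly intr 'Phi_n) z by rewrite Dz root_cyclotomic.
have rz : root (map_poly (intr : int -> algC) r) z.
  move: az; rewrite aE rmorphD rmorphM /= /root hornerD hornerM.
  by rewrite (eqP Phiz) mulr0 add0r.
have [m [mE mm mP]] := minCpolyP z.
have rQ : map_poly (intr : int -> algC) r = map_poly ratr (map_poly (intr : int -> rat) r).
  by rewrite -map_poly_comp; apply: eq_map_poly => x /=; rewrite ratr_int.
have sm : size m = size 'Phi_n.
  rewrite -(size_map_poly (ratr : rat -> algC)) -mE (minCpoly_cyclotomic zn) -Dz.
  by rewrite size_map_inj_poly ?rmorph0 //; exact: intr_inj.
have sr' : size (map_poly (intr : int -> rat) r) = size r.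
  by rewrite size_map_inj_poly ?rmorph0 //; exact: intr_inj.
move: rz; rewrite rQ mP => mr.
have r0 : r = 0.
  apply/eqP; apply: contraT => rn0.
  have rQ0 : map_poly (intr : int -> rat) r != 0.
    by rewrite -size_poly_eq0 sr' size_poly_eq0.
  by have := dvdp_leq rQ0 mr; rewrite sr' sm leqNgt sr.
by exists q; rewrite aE r0 addr0.
Qed.

Lemma poly_prime_Cyclotomic n : (0 < n)%N -> poly_prime 'Phi_n.
Proof.
move=> n0; split; first by rewrite monic_neq0 ?Cyclotomic_monic.
have [z zn] := C_prim_root_exists n0.
move=> a b [r /(congr1 (fun u => (map_poly (intr : int -> algC) u).[z]))].
rewrite !rmorphM /= !hornerM (Cintr_Cyclotomic zn).
have := root_cyclotomic zn z; rewrite zn => /eqP ->; rewrite mulr0.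
by move/eqP; rewrite mulf_eq0 => /orP[]; [left|right]; exact: (Cyclotomic_dvdP zn).
Qed.

Lemma int_poly_unit (a b : {poly int}) : a * b = 1 -> exists e : bool, a = (-1) ^+ e.
Proof.
move=> ab; have : a \is a GRing.unit.
  by apply/unitrP; exists b; rewrite mulrC ab.
rewrite poly_unitE => /andP[/eqP sa]; have -> : a = (a`_0)%:P.
  by apply: size1_polyC; rewrite sa.
rewrite coefC eqxx => /pred2P[] ->; first by exists false.
by exists true; rewrite expr1 polyCN.
Qed.

(** Each prime factor of the product divides [a] or [b] and can be cancelled
    there; what remains of [a] in the end is a unit. *)
Lemma dvd_prod_primes (ds : seq {poly int}) (a b : {poly int}) :
  (forall d, d \in ds -> poly_prime d) -> a * b = \prod_(d <- ds) d ->
  exists (e : bool) (s : seq {poly int}),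
    {subset s <= ds} /\ a = (-1) ^+ e * \prod_(d <- s) d.
Proof.
elim: ds a b => [|d ds IHds] a b dsP.
  rewrite big_nil => /int_poly_unit[e ->]; exists e, [::].
  by rewrite big_nil mulr1.
have [d0 dP] := dsP d (mem_head _ _).
have {}dsP d' : d' \in ds -> poly_prime d'.
  by move=> d'ds; apply: dsP; rewrite inE d'ds orbT.
rewrite big_cons => abE; have [|[r aE]|[r bE]] := dP a b.
- by rewrite abE mulrC; eexists.
- have /IHds[//|e [s [sds rE]]] : r * b = \prod_(j <- ds) j.
    by apply: (mulfI d0); rewrite -abE aE mulrA [d * r]mulrC.
  exists e, (d :: s); rewrite aE rE big_cons; split=> [x|]; last by rewrite -mulrA [X in _ * X]mulrC.
  by rewrite !inE => /orP[->//|/sds ->]; rewrite orbT.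
- have /IHds[//|e [s [sds aE]]] : a * r = \prod_(j <- ds) j.
    by apply: (mulfI d0); rewrite -abE bE mulrCA [d * r]mulrC mulrA.
  by exists e, s; split=> // x /sds; rewrite inE orbC => ->.
Qed.

Definition cyclotomic_factor (d : {poly int}) : Prop :=
  d = 'X \/ exists2 n, (0 < n)%N & d = 'Phi_n.

Lemma prod_cyclotomic_factors (s : seq {poly int}) :
  (forall d, d \in s -> cyclotomic_factor d) ->
  exists (i : nat) (ns : seq nat),
    all (leq 1) ns /\ \prod_(d <- s) d = 'X^i * \prod_(n <- ns) 'Phi_n.
Proof.
elim: s => [|d s IHs] sP.
  by exists 0%N, [::]; rewrite !big_nil mulr1.
have [d' d's|i [ns [ns1 sE]]] := IHs; first by apply: sP; rewrite inE d's orbT.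
rewrite big_cons sE; have [->|[n n0 ->]] := sP d (mem_head _ _).
  by exists i.+1, ns; rewrite mulrA exprS.
by exists i, (n :: ns); rewrite /= n0 ns1 big_cons mulrCA.
Qed.

(** The power of ['X] is what remains of the denominators of Laurent polynomials. *)
Lemma dvd_Xn_sub_1_exp (a b : {poly int}) (j m n : nat) : (0 < m)%N ->
  a * b = 'X^j * ('X^m - 1) ^+ n ->
  exists (e : bool) (i : nat) (ns : seq nat), all (leq 1) ns /\
    a = (-1) ^+ e * ('X^i * \prod_(k <- ns) 'Phi_k).
Proof.
move=> m0; pose ds := nseq j 'X ++ flatten (nseq n [seq 'Phi_d | d <- divisors m]).
have dsP d : d \in ds -> cyclotomic_factor d.
  rewrite mem_cat => /orP[|/flattenP[_ /nseqP[-> _] /mapP[k km ->]]].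
    by move/nseqP => [-> _]; left.
  right; exists k => //; move: km; rewrite -dvdn_divisors //; exact: dvdn_gt0.
have dsE : \prod_(d <- ds) d = 'X^j * ('X^m - 1) ^+ n.
  have iterE (x : {poly int}) k : iter k ( *%R x) 1 = x ^+ k.
    by elim: k => //= k ->; rewrite exprS.
  by rewrite big_cat big_nseq big_flatten /= big_nseq big_map prod_Cyclotomic // !iterE.
rewrite -dsE => /dvd_prod_primes[d /dsP[->|[k k0 ->]]|e [s [sds ->]]].
- exact: poly_prime_X.
- exact: poly_prime_Cyclotomic.
have [d /sds/dsP //|i [ns [ns1 ->]]] := @prod_cyclotomic_factors s.
by exists e, i, ns.
Qed.

(** ** Laurent polynomials *)

Lemma laurent_inj : injective laurent_val.
Proof. exact: val_inj. Qed.

Lemma tpowD (i j : int) : tpow (i + j) = tpow i * tpow j.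
Proof.
by apply: laurent_inj; rewrite /= expfzDr // tofrac_eq0 polyX_eq0.
Qed.

Lemma tpow0 : tpow 0 = 1.
Proof. by apply: laurent_inj; rewrite /= expr0z. Qed.

Lemma laurent_of_polyE (D : laurent) : exists (i : int) (q : {poly int}),
  D = tpow i * laurent_of_poly q.
Proof.
case: D => x xL; have /asboolP[n [q xE]] := xL.
exists (- n%:Z), q; apply: laurent_inj => /=; rewrite -xE mulrCA -exprnN mulVf ?mulr1 //.
by rewrite expf_neq0 // tofrac_eq0 polyX_eq0.
Qed.

Lemma laurent_of_poly_inj : injective laurent_of_poly.
Proof. by move=> x y /(congr1 laurent_val) /eqP; rewrite tofrac_eq => /eqP. Qed.

Lemma laurent_of_polyM : {morph laurent_of_poly : x y / x * y}.
Proof. by move=> x y; apply: laurent_inj; rewrite /= rmorphM. Qed.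

Lemma laurent_of_poly_exp (q : {poly int}) n :
  laurent_of_poly (q ^+ n) = laurent_of_poly q ^+ n.
Proof.
elim: n => [|n IHn]; first by apply: laurent_inj; rewrite /= rmorph1.
by rewrite !exprS laurent_of_polyM IHn.
Qed.

Lemma laurent_of_polyXn n : laurent_of_poly 'X^n = tpow n.
Proof. by apply: laurent_inj; rewrite /= rmorphXn. Qed.

Lemma laurent_dvd_tpow_sub_1 (D c : laurent) (m n : nat) : (0 < m)%N ->
  D * c = (tpow m - 1) ^+ n ->
  exists (b : bool) (i : int) (s : seq nat), all (leq 1) s /\
    D = (-1) ^+ b * tpow i * laurent_of_poly (\prod_(k <- s) 'Phi_k).
Proof.
move=> m0 DcE.
have [i [q DE]] := laurent_of_polyE D; have [j [r cE]] := laurent_of_polyE c.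
have uE : (tpow m - 1) ^+ n = laurent_of_poly (('X^m - 1) ^+ n).
  rewrite laurent_of_poly_exp; congr (_ ^+ _).
  by apply: laurent_inj; rewrite /= rmorphB rmorphXn rmorph1.
(* Multiplying by a power of t clears the negative exponents. *)
have [a [a' qrE]] : exists a a' : nat, (q * 'X^a) * r = 'X^a' * ('X^m - 1) ^+ n.
  have E : tpow (i + j) * laurent_of_poly (q * r) = laurent_of_poly (('X^m - 1) ^+ n).
    by rewrite -uE -DcE DE cE tpowD laurent_of_polyM; ring.
  case: (i + j) E => l E; [exists l, 0%N|exists 0%N, l.+1];
    apply: laurent_of_poly_inj; rewrite ?expr0 ?mul1r ?mulr1.
    apply: etrans E; rewrite -laurent_of_polyXn -laurent_of_polyM.
    by congr laurent_of_poly; ring.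
  rewrite [RHS]laurent_of_polyM laurent_of_polyXn.
  apply: etrans (congr1 ( *%R (tpow l.+1)) E).
  by rewrite mulrA -tpowD NegzE subrr tpow0 mul1r.
have [e [l [s [s1 qE]]]] := dvd_Xn_sub_1_exp m0 qrE.
exists e, (i - a%:Z + l%:Z), s; split => //.
have aE : tpow (i - a%:Z) * tpow a = tpow i by rewrite -tpowD subrK.
rewrite DE -aE -mulrA -laurent_of_polyXn -laurent_of_polyM mulrC [_ * q]mulrC qE.
rewrite !laurent_of_polyM laurent_of_polyXn [tpow (_ + l%:Z)]tpowD.
have -> : laurent_of_poly ((-1) ^+ e) = (-1) ^+ e.
  rewrite laurent_of_poly_exp; congr (_ ^+ _).
  by apply: laurent_inj; rewrite /= rmorphN rmorph1.
ring.
Qed.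

(** For negative [m] the two polynomials [t ^ m - 1] and [t ^ (- m) - 1] are
    associate. *)
Lemma laurent_dvd_tpow_int_sub_1 (D c : laurent) (m : int) (n : nat) : m != 0 ->
  (tpow m - 1) ^+ n = c * D ->
  exists (b : bool) (i : int) (s : seq nat), all (leq 1) s /\
    D = (-1) ^+ b * tpow i * laurent_of_poly (\prod_(k <- s) 'Phi_k).
Proof.
case: m => m m0 E.
  by apply: (@laurent_dvd_tpow_sub_1 _ c m n); rewrite ?lt0n // E mulrC.
apply: (@laurent_dvd_tpow_sub_1 _ (c * (- tpow m.+1) ^+ n) m.+1 n) => //.
rewrite mulrA [D * c]mulrC -E -exprMn; congr (_ ^+ n).
by rewrite mulrN mulrBl -tpowD NegzE addNr tpow0 mul1r opprB.
Qed.

(** * Modules annihilated by a scalar *)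

(** The formula of Cauchy and Binet, in the form in which the choices of rows are
    neither increasing nor injective. *)
Lemma det_mulmx_rowsub (L : comNzRingType) (m n : nat)
    (B : 'M[L]_(n, m)) (A : 'M[L]_(m, n)) :
  \det (B *m A) =
  \sum_(f : {ffun 'I_n -> 'I_m}) (\prod_i B i (f i)) * \det (rowsub f A).
Proof.
rewrite /determinant.
under [RHS]eq_bigr do rewrite big_distrr /=.
rewrite exchange_big; apply: eq_bigr => s _ /=.
under eq_bigr do rewrite mxE.
rewrite bigA_distr_bigA big_distrr; apply: eq_bigr => f _ /=.
rewrite big_split mulrCA; congr (_ * (_ * _)).
by apply: eq_bigr => i _; rewrite mxE.
Qed.

(** If [u] annihilates the module, then [u] times the identity matrix is a
    product [B A] with the presentation matrix [A], and the determinant of [B A]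
    is a combination of the maximal minors of [A]. *)
Lemma gcd_minors_dvd_annihilator (L : comNzRingType) (C : lmodType L)
    (Z B : set C) (m n : nat) (A : 'M[L]_(m, n)) (u d : L) :
  presentation_matrix Z B A ->
  (forall c, Z c -> B (u *: c)) ->
  is_gcd (fun f : {ffun 'I_n -> 'I_m} => \det (rowsub f A)) d ->
  exists c, u ^+ n = c * d.
Proof.
move=> [z [zZ _ zA]] uZB [dF _].
have bP j : exists b : 'rV[L]_m, u *: delta_mx 0 j = b *m A.
  apply/zA; rewrite (bigD1 j) //= big1 ?addr0; last first.
    by move=> k kj; rewrite !mxE eqxx (negbTE kj) mulr0 scale0r.
  by rewrite !mxE !eqxx mulr1; exact/uZB/zZ.
pose b j : 'rV_m := sval (cid (bP j)).
have bA : (\matrix_j b j) *m A = u%:M.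
  apply/row_matrixP => j; rewrite row_mul rowK -(svalP (cid (bP j))).
  by rewrite -scalemx1 [RHS]linearZ /= row1.
have := det_scalar n u; rewrite -bA det_mulmx_rowsub => <-.
pose c f : L := sval (cid (dF f)).
exists (\sum_(f : {ffun 'I_n -> 'I_m}) (\prod_i (\matrix_j b j) i (f i)) * c f).
rewrite big_distrl; apply: eq_bigr => f _ /=.
by rewrite -mulrA -(svalP (cid (dF f))).
Qed.

(** * Continuity *)

Lemma continuous_addr (R : realType) (Y : topologicalType) (f g : Y -> R) :
  continuous f -> continuous g -> continuous (fun y => f y + g y).
Proof. by move=> cf cg y; apply: cvgD; [exact: cf|exact: cg]. Qed.

Lemma continuous_subr (R : realType) (Y : topologicalType) (f g : Y -> R) :
  continuous f -> continuous g -> continuous (fun y => f y - g y).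
Proof. by move=> cf cg y; apply: cvgB; [exact: cf|exact: cg]. Qed.

Lemma continuous_mulr (R : realType) (Y : topologicalType) (f g : Y -> R) :
  continuous f -> continuous g -> continuous (fun y => f y * g y).
Proof. by move=> cf cg y; apply: cvgM; [exact: cf|exact: cg]. Qed.

Section PointwiseContinuity.
Variables (R : realType) (Y : topologicalType) (y : Y).
Implicit Types f g : Y -> R.

Lemma continuous_atD f g : {for y, continuous f} -> {for y, continuous g} ->
  {for y, continuous (fun z => f z + g z)}.
Proof. by move=> cf cg; apply: cvgD. Qed.

Lemma continuous_atM f g : {for y, continuous f} -> {for y, continuous g} ->
  {for y, continuous (fun z => f z * g z)}.
Proof. by move=> cf cg; apply: cvgM. Qed.

Lemma continuous_atV f : {for y, continuous f} -> f y != 0 ->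
  {for y, continuous (fun z => (f z)^-1)}.
Proof. by move=> cf f0; apply: cvgV. Qed.

Lemma continuous_at_pair (S T : topologicalType) (h : Y -> S) (h' : Y -> T) :
  {for y, continuous h} -> {for y, continuous h'} ->
  {for y, continuous (fun z => (h z, h' z))}.
Proof. by move=> ch ch'; apply: cvg_pair. Qed.

End PointwiseContinuity.

Lemma continuous_line (Y Z T : topologicalType) (F : Y * Z -> T) (y : Y) :
  continuous F -> continuous (fun t => F (y, t)).
Proof.
move=> cF; apply: continuous_compo cF.
apply: continuous_pair; first exact: cst_continuous.
by move=> t; exact: cvg_id.
Qed.

Lemma continuous_slice (Y Z T : topologicalType) (F : Y * Z -> T) (t : Z) :
  continuous F -> continuous (fun y => F (y, t)).
Proof.
move=> cF; apply: continuous_compo cF.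
apply: continuous_pair; last exact: cst_continuous.
by move=> y; exact: cvg_id.
Qed.

Lemma continuous_at_glue (R : realType) (Y T : topologicalType) (c : Y -> R)
    (a : R) (f g : Y -> T) (y : Y) :
  {for y, continuous c} ->
  (c y <= a -> {for y, continuous f}) -> (a <= c y -> {for y, continuous g}) ->
  (c y = a -> f y = g y) ->
  {for y, continuous (fun y => if c y <= a then f y else g y)}.
Proof.
move=> cc cf cg fg U; rewrite nbhs_filterE.
have nf : c y <= a -> nbhs (f y) U -> nbhs y (f @^-1` U) by move=> h; exact: cf.
have ng : a <= c y -> nbhs (g y) U -> nbhs y (g @^-1` U) by move=> h; exact: cg.
case: (ltgtP (c y) a) => [lt|gt|eq] nU.
- have : nbhs y (c @^-1` [set x | x < a]).
    by apply: cc; apply: open_nbhs_nbhs; split => //; exact: open_lt.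
  move/(filterI (nf (ltW lt) nU)); apply: filterS => z [/= Uz /ltW].
  by rewrite /preimage /= => ->.
- have : nbhs y (c @^-1` [set x | a < x]).
    by apply: cc; apply: open_nbhs_nbhs; split => //; exact: open_gt.
  move/(filterI (ng (ltW gt) nU)); apply: filterS => z [/= Uz].
  by rewrite /preimage /= ltNge => /negbTE ->.
- have nU' : nbhs (g y) U by rewrite -fg.
  have le1 : c y <= a by rewrite eq.
  have le2 : a <= c y by rewrite eq.
  have : nbhs y ((f @^-1` U) `&` (g @^-1` U)).
    exact: filterI (nf le1 nU) (ng le2 nU').
  apply: filterS => z [/= Uz Vz].
  by rewrite /preimage /=; case: ifP.
Qed.

Lemma near_eq_continuous_at (Y T : topologicalType) (f g : Y -> T) (y : Y) :
  nbhs y [set z | f z = g z] -> {for y, continuous f} -> {for y, continuous g}.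
Proof.
move=> nfg cf U; rewrite nbhs_filterE -(nbhs_singleton nfg) => nU.
have nfU : nbhs y (f @^-1` U) by exact: cf.
by apply: filterS (filterI nfg nfU) => z [/= fg]; rewrite /preimage /= fg.
Qed.

(** * Lifting homotopies through coverings *)

Section Covering.
Variables (E X : topologicalType) (p : E -> X).
Hypothesis covp : covering_map p.

(** To extend a lift, [U] is chosen first, around a point of the path downstairs;
    the sheet [V] is known only once the lift has entered it. *)
Lemma covering_section (x : X) : exists U : set X,
  [/\ open U, U x & forall e, U (p e) -> exists (V : set E) (s : X -> E),
    [/\ open V, V e, forall x, U x -> {for x, continuous s},
        forall x, U x -> p (s x) = x & forall e', V e' -> s (p e') = e']].
Proof.
have [cp sp /(_ x)[U [oU Ux [sheets [shO shD shU shS]]]]] := covp.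
exists U; split=> // e Upe.
have : (\bigcup_(V in sheets) V) e by rewrite -shU.
move=> [V shV Ve]; have [s [cs sV sK]] := shS V shV.
exists V, s; split => //.
- exact: shO.
- move=> y Uy; have := cs; rewrite continuous_open_subspace // => /(_ y).
  by apply; rewrite inE.
- by move=> y /sV[].
Qed.

(** Two points of one fibre lie in different sheets, or else the section of their
    common sheet would identify them. *)
Lemma covering_separates (e e' : E) : p e = p e' -> e <> e' ->
  exists V V' : set E, [/\ open V, open V', V e, V' e' & V `&` V' = set0].
Proof.
have [cp sp /(_ (p e))[U [oU Upe [sheets [shO shD shU shS]]]]] := covp.
move=> pee' ee'.
have : (\bigcup_(V in sheets) V) e by rewrite -shU.
have : (\bigcup_(V in sheets) V) e' by rewrite -shU /preimage /= -pee'.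
move=> [V' shV' V'e'] [V shV Ve]; exists V, V'; split => //; try exact: shO.
apply/eqP; apply: contrapT => /negP/set0P VV'; apply: ee'.
have VE : V = V' by apply: shD.
have [s [cs sV sK]] := shS V shV.
by rewrite -(sK e) // pee' sK // VE.
Qed.

(** The set where two lifts agree is open by the local sections and closed by the
    separation of the sheets. *)
Lemma lift_unique (Y : topologicalType) (u v : Y -> E) (y0 : Y) :
  connected [set: Y] -> continuous u -> continuous v ->
  (forall y, p (u y) = p (v y)) -> u y0 = v y0 -> forall y, u y = v y.
Proof.
move=> cY cu cv puv uv0.
pose A := [set y | u y = v y].
suff AT : A = setT by move=> y; have : A y by rewrite AT.
apply: cY; first by exists y0.
- exists A; last by rewrite setTI.
  rewrite openE => y Ay; rewrite /interior.
  have [U [oU Uy /(_ (u y))[//|V [s [oV Vy cs ps sK]]]]] := covering_section (p (u y)).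
  have nu : nbhs y (u @^-1` V) by apply: cu; exact: open_nbhs_nbhs.
  have nv : nbhs y (v @^-1` V).
    by apply: cv; apply: open_nbhs_nbhs; split => //; rewrite -Ay.
  by apply: filterS (filterI nu nv) => z [/= Vu Vv]; rewrite /A /= -(sK (u z)) // puv sK.
- exists A; last by rewrite setTI.
  rewrite -[A]setCK; apply: open_closedC; rewrite openE => y Ay; rewrite /interior.
  have [V [V' [oV oV' Vy V'y VV']]] := covering_separates (puv y) Ay.
  have nu : nbhs y (u @^-1` V) by apply: cu; exact: open_nbhs_nbhs.
  have nv : nbhs y (v @^-1` V') by apply: cv; exact: open_nbhs_nbhs.
  apply: filterS (filterI nu nv) => z [/= Vu Vv] Az.
  have uvz : u z = v z by [].
  have : (V `&` V') (u z) by split => //; rewrite uvz.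
  by rewrite VV'.
Qed.

End Covering.

Section HomotopyLifting.
Variable R : realType.
Local Notation I := (unit_interval R).

Lemma connected_unit_interval : connected [set: I].
Proof.
have -> : [set: I] = @clamp R @` [set: R].
  by apply/seteqP; split => // s _; exists (ui_val s) => //; exact: clampK.
apply: connected_continuous_connected.
  by apply/connected_intervalP => x y _ _ z _.
by apply: continuous_subspaceT; exact: clamp_continuous.
Qed.

(** Induction along the line: otherwise the step at the supremum of [P] would
    lead beyond it. *)
Lemma real_induction (P : R -> Prop) :
  (exists t, P t) -> (forall t t', t' <= t -> P t -> P t') ->
  (forall t, exists2 d, 0 < d & forall t', t - d < t' -> P t' -> P (t + d)) ->
  forall t, P t.
Proof.
move=> Pex Pdown Pstep t; apply: contrapT => nPt.
have ubP : has_sup [set t | P t].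
  split=> //; exists t => t' Pt'; rewrite leNgt; apply/negP => lt.
  exact/nPt/(Pdown t')/Pt'/ltW.
have [d d0 step] := Pstep (sup [set t | P t]).
have [t' Pt' lt] := sup_adherent d0 ubP.
have := sup_upper_bound ubP (step _ lt Pt').
by rewrite gerDl leNgt d0.
Qed.

Variables (E X : topologicalType) (p : E -> X).
Hypothesis covp : covering_map p.

Section Local.
Variables (Y : topologicalType) (G : Y * R -> X) (g0 : Y -> E) (y0 : Y).
Hypotheses (cG : continuous G) (cg0 : continuous g0).
Hypothesis G0 : forall y t, t <= 0 -> G (y, t) = p (g0 y).

(** The lift is defined for all times less than [T], negative ones included, so
    that its domain is open and continuity is continuity at each point. *)
Definition local_lift (T : R) (U : set Y) (h : Y * R -> E) : Prop :=
  [/\ open U, U y0 & forall y t, U y -> t < T ->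
      [/\ {for (y, t), continuous h}, p (h (y, t)) = G (y, t) &
          (t <= 0 -> h (y, t) = g0 y)]].

(** Near [(y0, t)] the map [G] stays in an evenly covered set. A lift that is
    defined up to some time [t1] close enough to [t] continues through the section
    of the sheet that it has reached at [t1]. *)
Lemma local_lift_exists T : exists U h, local_lift T U h.
Proof.
apply: (@real_induction (fun T => exists U h, local_lift T U h)).
- exists 0, setT, (fun z => g0 z.1); split=> //; first exact: openT.
  move=> y t _ t0; split => //; last by rewrite G0 // ltW.
  exact: (continuous_compo (@fst_continuous _ _) cg0).
- move=> t t' tt' [U [h [oU Uy0 hP]]]; exists U, h; split=> // y s Uy st.
  by apply: hP => //; exact: lt_le_trans tt'.
move=> t.
have [W [oW Wt WP]] := covering_section covp (G (y0, t)).
have [[A B] /= [nA nB] AB] : nbhs (y0, t) (G @^-1` W).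
  by apply: cG; exact: open_nbhs_nbhs.
have [d /= d0 dB] : exists2 d, 0 < d & forall s, `|t - s| < d -> B s.
  by have /nbhs_ballP[d d0 dB] := nB; exists d => // s ts; exact: dB.
exists (d / 2); first by rewrite divr_gt0.
move=> t' tt' [U [h [oU Uy0 hP]]].
(* The minimum with [t] keeps [t1] in the box even if [t'] is large. *)
have [t1 [t1t tt1]] : exists t1, t1 < t' /\ t - d < t1 < t + d / 2.
  have le1 : Num.min ((t - d / 2 + t') / 2) t <= t by rewrite ge_min lexx orbT.
  have le2 : Num.min ((t - d / 2 + t') / 2) t <= (t - d / 2 + t') / 2.
    by rewrite ge_min lexx.
  exists (Num.min ((t - d / 2 + t') / 2) t); split; first lra.
  by rewrite lt_min -andbA; apply/and3P; split; lra.
have inB r : t - d < r < t + d -> B r by move=> ?; apply: dB; rewrite ltr_norml; lra.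
have [cht1 ph1 hg0] := hP _ _ Uy0 t1t.
have GW y r : A y -> t - d < r < t + d -> W (G (y, r)).
  by move=> Ay rt; apply: (AB (y, r)); split => //; exact: inB.
have Ay0 : A y0 by exact: nbhs_singleton nA.
have [|V [s [oV Vh cs ps sK]]] := WP (h (y0, t1)).
  by rewrite ph1; apply: GW => //; lra.
have nV : nbhs y0 [set y | V (h (y, t1))].
  have c1 : {for y0, continuous (fun y => h (y, t1))}.
    apply: (@continuous_comp _ _ _ (fun y => (y, t1)) h) => //.
    apply: (@continuous_pair Y Y R id (cst t1)) => z; first exact: cvg_id.
    exact: cvg_cst.
  by apply: c1; exact: open_nbhs_nbhs.
have nU : nbhs y0 U by exact: open_nbhs_nbhs.
have nU' := filterI nU (filterI nA nV).
exists (interior (U `&` (A `&` [set y | V (h (y, t1))]))).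
exists (fun z => if z.2 <= t1 then h z else s (G z)).
split; [exact: open_interior|exact: nU'|].
move=> y r /interior_subset [Uy [Ay /= Vy]] rt.
have Wr : t1 <= r -> W (G (y, r)) by move=> t1r; apply: GW => //; lra.
have hs : r = t1 -> h (y, r) = s (G (y, r)).
  by move=> ->; have [_ <- _] := hP y t1 Uy t1t; rewrite sK.
split.
- apply: continuous_at_glue.
  + exact: snd_continuous.
  + by move=> rt1; have [] := hP y r Uy (le_lt_trans rt1 t1t).
  + move=> t1r; apply: (@continuous_comp _ _ _ G s); first exact: cG.
    by apply: cs; exact: Wr.
  + exact: hs.
- case: ifP => /= [rt1|/negbT]; first by have [] := hP y r Uy (le_lt_trans rt1 t1t).
  by rewrite -ltNge => /ltW/Wr/ps.
- case: ifP => /= [rt1|/negbT]; first by have [] := hP y r Uy (le_lt_trans rt1 t1t).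
  rewrite -ltNge => t1r r0.
  have [_ _ h0] := hP y t1 Uy t1t; have {}h0 : h (y, t1) = g0 y by apply: h0; lra.
  by rewrite G0 // -h0 sK.
Qed.

End Local.

(** Lifts along the lines [{y} * I] are unique, so that the local lifts, each
    defined near a line, agree where they meet. *)
Theorem homotopy_lifting (Y : topologicalType) (G : Y * I -> X) (g0 : Y -> E) :
  continuous G -> continuous g0 -> (forall y, p (g0 y) = G (y, zero)) ->
  exists K : Y * I -> E,
    [/\ continuous K, forall z, p (K z) = G z & forall y, K (y, zero) = g0 y].
Proof.
move=> cG cg0 G0.
pose G' (z : Y * R) := G (z.1, clamp z.2).
have cG' : continuous G'.
  apply: (continuous_compo _ cG); apply: continuous_pair.
    exact: fst_continuous.
  exact: (continuous_compo (@snd_continuous _ _) (@clamp_continuous R)).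
have G'0 y t : t <= 0 -> G' (y, t) = p (g0 y).
  move=> t0; rewrite G0 /G' /=; congr (G (y, _)); apply: ui_val_inj.
  by rewrite ui_zero /ui_val /= max_l // ge_min t0 orbT.
have L y := cid (local_lift_exists y cG' cg0 G'0 2).
pose h y := sval (cid (svalP (L y))).
have hP y : local_lift G' g0 y 2 (sval (L y)) (h y) := svalP (cid (svalP (L y))).
have I2 (s : I) : ui_val s < 2 by have /andP[_ ?] := ui_valP s; lra.
pose K (z : Y * I) := h z.1 (z.1, ui_val z.2).
have yU y : sval (L y) y by have [] := hP y.
have hK y y' (s : I) : sval (L y) y' -> h y (y', ui_val s) = K (y', s).
  move=> Uy'; rewrite /K /=.
  have ch (z : Y) : sval (L z) y' -> continuous (fun r : I => h z (y', ui_val r)).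
    move=> Uzy' r; have [_ _ /(_ y' (ui_val r) Uzy' (I2 r))[ch _ _]] := hP z.
    apply: (@continuous_comp _ _ _ (fun r : I => (y', ui_val r)) (h z)) => //.
    apply: (@continuous_pair I Y R (cst y') (@ui_val R)).
      exact: cst_continuous.
    exact: ui_val_continuous.
  apply: (lift_unique covp connected_unit_interval (ch y Uy') (ch y' (yU y')) (y0 := zero)).
    move=> r; have [_ _ /(_ y' (ui_val r) Uy' (I2 r))[_ -> _]] := hP y.
    by have [_ _ /(_ y' (ui_val r) (yU y') (I2 r))[_ -> _]] := hP y'.
  have z0 : ui_val (zero : I) <= 0 by rewrite ui_zero.
  have [_ _ /(_ y' (ui_val zero) Uy' (I2 zero))[_ _ ->//]] := hP y.
  by have [_ _ /(_ y' (ui_val zero) (yU y') (I2 zero))[_ _ ->//]] := hP y'.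
exists K; split.
- move=> [y s]; have [oU _ /(_ y (ui_val s) (yU y) (I2 s))[ch _ _]] := hP y.
  have : {for (y, s), continuous (fun z : Y * I => h y (z.1, ui_val z.2))}.
    apply: (@continuous_comp _ _ _ (fun z : Y * I => (z.1, ui_val z.2)) (h y)) => //.
    apply: (@continuous_pair _ _ _ fst (fun z : Y * I => ui_val z.2)).
      exact: fst_continuous.
    exact: (continuous_compo (@snd_continuous _ _) (@ui_val_continuous R)).
  apply: near_eq_continuous_at.
  exists (sval (L y), setT); first by split; [apply: open_nbhs_nbhs; split => //; exact: yU|exact: filterT].
  by move=> [y' s'] [/= Uy' _]; exact: hK.
- move=> [y s]; have [_ _ /(_ y (ui_val s) (yU y) (I2 s))[_ -> _]] := hP y.
  by rewrite /G' /= clampK.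
- move=> y; have z0 : ui_val (zero : I) <= 0 by rewrite ui_zero.
  rewrite /K; have [_ _ /(_ y (ui_val zero) (yU y) (I2 zero))[_ _ h0]] := hP y.
  exact: h0.
Qed.

End HomotopyLifting.

(** * Additive maps on chains *)

Section ChainEvaluation.
Variables (R : realType) (E : topologicalType) (N n : nat).
Implicit Types (c d : chain R E N n) (s : singular_simplex R E n).

Lemma chainD c d s : (c + d) s = c s + d s. Proof. by []. Qed.

Lemma chainN c s : (- c) s = - c s. Proof. by []. Qed.

Lemma chainZ (a : laurent) c s : (a *: c) s = a *: c s. Proof. by []. Qed.

End ChainEvaluation.

Local Notation finite_support := Defs.finite_support.

Section Extension.
Variables (R : realType) (E : topologicalType) (N n : nat) (V : zmodType).
Local Notation T := (singular_simplex R E n).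
Local Notation W := 'rV[laurent]_N.
Implicit Types (phi : T -> W -> V) (c d : chain R E N n).

(** The additive map on chains that sends the pure tensor of [w] and [s] to
    [phi s w]; the differential is the case of the alternating sum of faces. *)
Definition extend phi c : V := \sum_(s \in [set: T]) phi s (c s).

Lemma finite_supportP c :
  finite_support c <-> exists r : seq T, forall s, s \notin r -> c s = 0.
Proof.
split=> [/finite_seqP[r rE]|[r rP]].
  exists r => s sr; apply/eqP; apply: contraNT sr => cs.
  by have : [set s | c s != 0] s by []; rewrite rE.
apply: (@sub_finite_set _ _ [set` r]); last exact: finite_seq.
by move=> s /= cs; apply: contraNT cs => /rP ->.
Qed.

Lemma finite_support0 : finite_support (0 : chain R E N n).
Proof. by apply/finite_supportP; exists [::]. Qed.

Lemma finite_support_pure w s : finite_support (pure_tensor w s : chain R E N n).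
Proof.
apply/finite_supportP; exists [:: s] => s'; rewrite inE /pure_tensor.
by case: eqP.
Qed.

Lemma finite_supportD c d :
  finite_support c -> finite_support d -> finite_support (c + d).
Proof.
move=> /finite_supportP[r rP] /finite_supportP[q qP].
apply/finite_supportP; exists (r ++ q) => s.
rewrite mem_cat negb_or => /andP[/rP cs /qP ds].
by rewrite chainD cs ds addr0.
Qed.

Lemma finite_supportN c : finite_support c -> finite_support (- c).
Proof.
move=> /finite_supportP[r rP]; apply/finite_supportP; exists r => s /rP cs.
by rewrite chainN cs oppr0.
Qed.

Lemma extendE phi c r : (forall s, phi s 0 = 0) -> uniq r ->
  (forall s, s \notin r -> c s = 0) -> extend phi c = \sum_(s <- r) phi s (c s).
Proof.
move=> phi0 ur rP; rewrite /extend (fsbigE r) // => [|s _ /rP ->//].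
by apply: eq_bigl => s; rewrite in_setT.
Qed.

Lemma extend_pure phi w s : (forall s, phi s 0 = 0) ->
  extend phi (pure_tensor w s) = phi s w.
Proof.
move=> phi0; rewrite (@extendE _ _ [:: s]) //.
  by rewrite big_seq1 /pure_tensor eqxx.
by move=> s'; rewrite inE /pure_tensor; case: eqP.
Qed.

Lemma extend0 phi : (forall s, phi s 0 = 0) -> extend phi 0 = 0.
Proof. by move=> phi0; rewrite (@extendE _ _ [::]) ?big_nil. Qed.

Lemma extendD phi c d : (forall s, {morph phi s : v w / v + w}) ->
  finite_support c -> finite_support d ->
  extend phi (c + d) = extend phi c + extend phi d.
Proof.
move=> phiD; have phi0 s : phi s 0 = 0 by apply: (addrI (phi s 0)); rewrite -phiD !addr0.
move=> /finite_supportP[r rP] /finite_supportP[q qP].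
have rqP s : s \notin undup (r ++ q) -> c s = 0 /\ d s = 0.
  by rewrite mem_undup mem_cat negb_or => /andP[/rP cs /qP ds].
rewrite !(@extendE _ _ (undup (r ++ q))) ?undup_uniq //; last first.
- by move=> s /rqP[cs ds]; rewrite chainD cs ds addr0.
- by move=> s /rqP[].
- by move=> s /rqP[].
by rewrite -big_split; apply: eq_bigr => s _ /=; rewrite -phiD.
Qed.

Lemma extendN phi c : (forall s, {morph phi s : v w / v + w}) ->
  finite_support c -> extend phi (- c) = - extend phi c.
Proof.
move=> phiD fc; have phi0 s : phi s 0 = 0 by apply: (addrI (phi s 0)); rewrite -phiD !addr0.
apply/eqP; rewrite -subr_eq0 opprK -extendD ?addNr ?extend0 //.
exact: finite_supportN.
Qed.

(** Identities between additive maps on chains reduce to pure tensors. *)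
Lemma finite_support_ind (P : chain R E N n -> Prop) :
  P 0 ->
  (forall w s c, finite_support c -> P c -> P (pure_tensor w s + c)) ->
  forall c, finite_support c -> P c.
Proof.
move=> P0 PD c /finite_supportP[r]; elim: r c => [|s r IHr] c rP.
  by have -> : c = 0 by apply/funext => s; exact: rP.
pose d : chain R E N n := fun s' => if s' == s then 0 else c s'.
have dP s' : s' \notin r -> d s' = 0.
  by rewrite /d; case: eqP => // /eqP s's s'r; apply: rP; rewrite inE negb_or s's.
have -> : c = pure_tensor (c s) s + d.
  apply/funext => s'; rewrite chainD /pure_tensor /d.
  by case: eqP => [->|_]; rewrite ?addr0 ?add0r.
by apply: PD; [apply/finite_supportP; exists r|exact: IHr].
Qed.

End Extension.

Section PureTensor.
Variables (R : realType) (E : topologicalType) (N n : nat).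
Local Notation T := (singular_simplex R E n).
Local Notation W := 'rV[laurent]_N.

Lemma pure_tensorD (v w : W) (s : T) :
  pure_tensor (v + w) s = pure_tensor v s + pure_tensor w s :> chain R E N n.
Proof.
apply/funext => s'; rewrite chainD.
by rewrite /pure_tensor; case: eqP; rewrite ?addr0.
Qed.

Lemma pure_tensor0 (s : T) : pure_tensor 0 s = 0 :> chain R E N n.
Proof. by apply/funext => s'; rewrite /pure_tensor; case: eqP. Qed.

Lemma pure_tensorN (w : W) (s : T) :
  pure_tensor (- w) s = - pure_tensor w s :> chain R E N n.
Proof. by apply/eqP; rewrite -addr_eq0 -pure_tensorD addNr pure_tensor0. Qed.

End PureTensor.

Section Differential.
Variables (R : realType) (E : topologicalType) (N n : nat).
Local Notation W := 'rV[laurent]_N.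
Local Notation chain := (chain R E N).

Definition boundary_of (s : singular_simplex R E n.+1) (w : W) : chain n :=
  \sum_(i < n.+2) pure_tensor ((-1) ^+ i *: w) (face i s).

Lemma differentialE (c : chain n.+1) : differential c = extend boundary_of c.
Proof. by []. Qed.

Lemma boundary_ofD s : {morph boundary_of s : v w / v + w}.
Proof.
move=> v w; rewrite /boundary_of -big_split; apply: eq_bigr => i _.
by rewrite scalerDr pure_tensorD.
Qed.

Lemma boundary_of0 s : boundary_of s 0 = 0.
Proof. by apply: big1 => i _; rewrite scaler0 pure_tensor0. Qed.

Lemma differentialD (c d : chain n.+1) : finite_support c -> finite_support d ->
  differential (c + d) = differential c + differential d.
Proof. move=> fc fd; rewrite !differentialE; apply: extendD => //; exact: boundary_ofD. Qed.

Lemma differential_pure w s :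
  differential (pure_tensor w s : chain n.+1) = boundary_of s w.
Proof. by rewrite differentialE extend_pure //; exact: boundary_of0. Qed.

Lemma finite_support_sum (I : Type) (r : seq I) (F : I -> chain n) :
  (forall i, finite_support (F i)) -> finite_support (\sum_(i <- r) F i).
Proof.
by move=> fF; elim/big_ind: _ => //; [exact: finite_support0|exact: finite_supportD].
Qed.

Lemma finite_support_differential (c : chain n.+1) :
  finite_support c -> finite_support (differential c).
Proof.
move: c; apply: finite_support_ind.
  by rewrite differentialE extend0; [exact: finite_support0|exact: boundary_of0].
move=> w s c fc IHc; rewrite differentialD //; last exact: finite_support_pure.
apply: finite_supportD => //; rewrite differential_pure.
by apply: finite_support_sum => i; exact: finite_support_pure.
Qed.

End Differential.

(** * A homotopy from the identity to itself acts on twisted homology *)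

Section IdentityHomotopy.
Variables (R : realType).
Local Notation I := (unit_interval R).

Definition continuous_fun (A B : topologicalType) (f : A -> B)
  (cf : continuous f) : continuousType A B :=
  HB.pack f (isContinuous.Build A B f cf).

(** The loop along which a homotopy from the identity to itself moves [x]. *)
Definition trace (X : topologicalType) (H : X * I -> X) (cH : continuous H)
    (H0 : forall x, H (x, zero) = x) (H1 : forall x, H (x, one) = x) (x : X) :
    {path I from x to x} :=
  mk_path (continuous_line (y := x) cH) (H0 x) (H1 x).

Variables (E X : topologicalType) (p : E -> X).
Hypothesis covp : covering_map p.
Variables (H : X * I -> X) (cH : continuous H).
Hypotheses (H0 : forall x, H (x, zero) = x) (H1 : forall x, H (x, one) = x).

Lemma lift_homotopy_unique (u v : I -> E) : continuous u -> continuous v ->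
  (forall t, p (u t) = p (v t)) -> u zero = v zero -> u =1 v.
Proof.
by move=> cu cv puv uv0 t; exact: (lift_unique covp (@connected_unit_interval R) cu cv puv uv0).
Qed.

Let revI (t : I) : I := clamp (1 - ui_val t).

Let continuous_revI : continuous revI.
Proof.
apply: continuous_clamp => t; apply: continuousB; first exact: cst_continuous.
exact: ui_val_continuous.
Qed.

Let revI0 : revI zero = one. Proof. by rewrite /revI ui_zero subr0. Qed.
Let revI1 : revI one = zero. Proof. by rewrite /revI ui_one subrr. Qed.
Let revIK t : revI (revI t) = t.
Proof.
have /andP[t0 t1] := ui_valP t; rewrite /revI clampE ?subKr ?clampK //.
by apply/andP; split; lra.
Qed.

(** The lift starts at the identity. It commutes with every deck transformation
    because both composites lift the same path from the same point. *)
Lemma identity_homotopy_lift : exists K : E * I -> E,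
  [/\ continuous K, forall e, K (e, zero) = e, forall z, p (K z) = H (p z.1, z.2) &
      forall D : E -> E, continuous D -> p \o D =1 p ->
        forall e t, K (D e, t) = D (K (e, t))].
Proof.
have [cp _ _] := covp.
have cG : continuous (fun z : E * I => H (p z.1, z.2)).
  apply: (continuous_compo _ cH); apply: continuous_pair.
    exact: (continuous_compo (@fst_continuous _ _) cp).
  exact: snd_continuous.
have [|e|K [cK pK K0]] := homotopy_lifting covp cG (g0 := id).
- by move=> e; exact: cvg_id.
- by rewrite /= H0.
exists K; split=> // D cD pD e; apply: lift_homotopy_unique.
- exact: (continuous_line cK).
- exact: (continuous_compo (continuous_line cK) cD).
- move=> t; have pDE e' : p (D e') = p e' := pD e'.
  by rewrite pDE !pK /= pDE.
- by rewrite !K0.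
Qed.

(** The inverse of the end of the lift is the end of the lift of the reversed
    homotopy; the path from [e0] in the lift projects onto the trace. *)
Lemma identity_homotopy_deck (e0 : E) (K : E * I -> E) :
  continuous K -> (forall e, K (e, zero) = e) ->
  (forall z, p (K z) = H (p z.1, z.2)) ->
  deck_of (loop_class (trace cH H0 H1 (p e0))) (fun e => K (e, one)).
Proof.
move=> cK K0 pK; have [cp _ _] := covp.
have pK1 e : p (K (e, one)) = p e by rewrite pK /= H1.
have cG : continuous (fun z : E * I => H (p z.1, revI z.2)).
  apply: (continuous_compo _ cH); apply: continuous_pair.
    exact: (continuous_compo (@fst_continuous _ _) cp).
  exact: (continuous_compo (@snd_continuous _ _) continuous_revI).
have [|e|L [cL pL L0]] := homotopy_lifting covp cG (g0 := id).
- by move=> e; exact: cvg_id.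
- by rewrite /= revI0 H1.
have pL1 e : p (L (e, one)) = p e by rewrite pL /= revI1 H0.
split; first split.
- split; first exact: (continuous_slice cK).
  exists (fun e => L (e, one)); split; first exact: (continuous_slice cL).
  + move=> e.
    have -> : L (K (e, one), one) = K (e, revI one).
      apply: (lift_homotopy_unique (u := fun t => L (K (e, one), t))
        (v := fun t => K (e, revI t))).
      * exact: (continuous_line cL).
      * exact: (continuous_compo continuous_revI (continuous_line cK)).
      * by move=> t; rewrite pL pK /= pK1.
      * by rewrite L0 revI0.
    by rewrite revI1 K0.
  + move=> e.
    have -> : K (L (e, one), one) = L (e, revI one).
      apply: (lift_homotopy_unique (u := fun t => K (L (e, one), t))
        (v := fun t => L (e, revI t))).
      * exact: (continuous_line cK).
      * exact: (continuous_compo continuous_revI (continuous_line cL)).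
      * by move=> t; rewrite pL pK /= pL1 revIK.
      * by rewrite K0 revI0.
    by rewrite revI1 L0.
- by move=> e; exact: pK1.
exists (trace cH H0 H1 (p e0)).
exists (mk_path (continuous_line (y := e0) cK) (K0 e0) (erefl (K (e0, one)))).
by split => // t; rewrite /= /mk_path pK.
Qed.

End IdentityHomotopy.

(** * The prism over a singular simplex *)

Section Simplices.
Variable R : realType.
Local Notation I := (unit_interval R).
Local Notation simplex := (std_simplex R).

Definition coord n (j : 'I_n.+1) (x : simplex n) : R := (set_val x : 'rV[R]_n.+1) 0 j.

Lemma coord_ge0 n (j : 'I_n.+1) (x : simplex n) : 0 <= coord j x.
Proof. by have := valP x; rewrite inE => -[x0 x1]; exact: x0. Qed.

Lemma coord_sum n (x : simplex n) : \sum_j coord j x = 1.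
Proof. by have := valP x; rewrite inE => -[x0 x1]; exact: x1. Qed.

Lemma simplex_eq n (x y : simplex n) : (forall j, coord j x = coord j y) -> x = y.
Proof. by move=> xy; apply/val_inj/rowP => j; exact: xy. Qed.

Lemma continuous_coord n (j : 'I_n.+1) : continuous (@coord n j).
Proof.
apply: (@continuous_compo _ _ _ set_val (fun y : 'rV[R]_n.+1 => y 0 j)).
  exact: initial_continuous.
exact: coord_continuous.
Qed.

Lemma continuous_to_simplex n (Y : topologicalType) (f : Y -> simplex n) :
  (forall j, continuous (fun y => coord j (f y))) -> continuous f.
Proof.
move=> cj.
have near_row (y : Y) (P : 'I_n.+1 -> set R) :
    (forall j, nbhs (coord j (f y)) (P j)) ->
    nbhs y [set z : Y | forall j, P j (coord j (f z))].
  move=> nP; apply: (@filter_forall Y _ (fun j z =>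
    P j (coord j (f z))) (nbhs y) (nbhs_filter y)) => j.
  exact: (cj j y _ (nP j)).
apply: continuous_comp_initial => y U [P nP sPU].
apply: (@filterS Y _ (nbhs_filter y) _ _ _
  (near_row y (P 0) (nP 0))) => z Pz.
by apply: sPU => a j; rewrite (ord1 a); exact: Pz.
Qed.

Lemma simplex_of_subproof n (v : 'I_n.+1 -> R) :
  (forall j, 0 <= v j) -> \sum_j v j = 1 ->
  (\row_j v j) \in [set x : 'rV[R]_n.+1 | (forall i, 0 <= x 0 i) /\ \sum_i x 0 i = 1].
Proof.
move=> v0 v1; rewrite inE; split => /=; first by move=> j; rewrite mxE.
by rewrite -[RHS]v1; apply: eq_bigr => j _; rewrite mxE.
Qed.

Definition simplex_of n (v : 'I_n.+1 -> R) (v0 : forall j, 0 <= v j)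
    (v1 : \sum_j v j = 1) : simplex n :=
  exist (fun y => y \in [set y : 'rV[R]_n.+1 |
    (forall i, 0 <= y 0 i) /\ \sum_i y 0 i = 1]) _ (simplex_of_subproof v0 v1).

Lemma coord_simplex_of n (v : 'I_n.+1 -> R) v0 v1 j :
  coord j (@simplex_of n v v0 v1) = v j.
Proof. by rewrite /coord /= mxE. Qed.

Lemma coord_face n (i : 'I_n.+2) (j : 'I_n.+2) (x : simplex n) :
  coord j (face_map i x) = if unlift i j is Some k then coord k x else 0.
Proof. by rewrite /coord /= mxE. Qed.

Lemma continuous_coord_sum n (r : seq 'I_n.+1) (P : pred 'I_n.+1) :
  continuous (fun x : simplex n => \sum_(i <- r | P i) coord i x).
Proof.
elim: r => [|i r IHr].
  by under eq_fun do rewrite big_nil; exact: cst_continuous.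
under eq_fun do rewrite big_cons.
case: (P i); last exact: IHr.
by apply: continuous_addr => //; exact: continuous_coord.
Qed.

Lemma sum_coord_face n (i : 'I_n.+2) (P : pred 'I_n.+2) (x : simplex n) :
  \sum_(j | P j) coord j (face_map i x) = \sum_(j | P (lift i j)) coord j x.
Proof.
rewrite big_mkcond (bigD1_ord i) //= coord_face unlift_none if_same add0r.
by rewrite [RHS]big_mkcond; apply: eq_bigr => j _; rewrite coord_face liftK.
Qed.

(** The barycentric coordinates of the image of [x] under the simplicial map that
    sends the vertex [i] to the vertex [f i]. *)
Definition vertex_weights n m (f : 'I_n.+1 -> 'I_m.+1) (x : simplex n) (j : 'I_m.+1) : R :=
  \sum_(i | f i == j) coord i x.

Lemma vertex_weights_ge0 n m (f : 'I_n.+1 -> 'I_m.+1) (x : simplex n) j :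
  0 <= vertex_weights f x j.
Proof. by apply: sumr_ge0 => i _; exact: coord_ge0. Qed.

Lemma vertex_weights_sum n m (f : 'I_n.+1 -> 'I_m.+1) (x : simplex n) :
  \sum_j vertex_weights f x j = 1.
Proof.
rewrite -[RHS](coord_sum x) /vertex_weights.
by rewrite [RHS](partition_big f xpredT).
Qed.

Definition vertex_map n m (f : 'I_n.+1 -> 'I_m.+1) (x : simplex n) : simplex m :=
  simplex_of (vertex_weights_ge0 f x) (vertex_weights_sum f x).

Lemma continuous_vertex_map n m (f : 'I_n.+1 -> 'I_m.+1) : continuous (vertex_map f).
Proof.
apply: continuous_to_simplex => j.
have -> : (fun y => coord j (vertex_map f y)) = (fun y => vertex_weights f y j).
  by apply/funext => y; rewrite coord_simplex_of.
exact: continuous_coord_sum.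
Qed.

Lemma vertex_map_id n (x : simplex n) : vertex_map id x = x.
Proof.
by apply: simplex_eq => j; rewrite coord_simplex_of /vertex_weights big_pred1_eq.
Qed.

Lemma vertex_map_face n m (f : 'I_n.+2 -> 'I_m.+1) (i : 'I_n.+2) (x : simplex n) :
  vertex_map f (face_map i x) = vertex_map (f \o lift i) x.
Proof.
by apply: simplex_eq => j; rewrite !coord_simplex_of /vertex_weights sum_coord_face.
Qed.

Lemma face_vertex_map n m (f : 'I_n.+1 -> 'I_m.+1) (k : 'I_m.+2) (x : simplex n) :
  face_map k (vertex_map f x) = vertex_map (lift k \o f) x.
Proof.
apply: simplex_eq => j; rewrite coord_face coord_simplex_of /vertex_weights.
case: unliftP => [l ->|->] /=.
  by rewrite coord_simplex_of; apply: eq_bigl => i; rewrite (inj_eq lift_inj).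
by rewrite big_pred0 // => i; apply/negbTE; rewrite eq_sym neq_lift.
Qed.

Variables (E : topologicalType) (K : E * I -> E).
Hypothesis cK : continuous K.

Section PrismSimplex.
Variables (n m : nat) (s : singular_simplex R E m).
Variables (f : 'I_n.+1 -> 'I_m.+1) (g : 'I_n.+1 -> bool).

(** The affine simplices of the prism over [s]: the vertex [i] lies above the
    vertex [f i] of [s], at the end of the homotopy if [g i] holds and at its
    beginning otherwise. *)
Definition prism_fun (x : simplex n) : E :=
  K (s (vertex_map f x), clamp (\sum_(i | g i) coord i x)).

Lemma continuous_prism_fun : continuous prism_fun.
Proof.
apply: (continuous_compo _ cK); apply: continuous_pair.
  have cs : continuous s by exact: cts_fun.
  exact: (continuous_compo (@continuous_vertex_map _ _ f) cs).
exact: (continuous_compo (@continuous_coord_sum _ _ _) (@clamp_continuous R)).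
Qed.

Definition prism : singular_simplex R E n := continuous_fun continuous_prism_fun.

End PrismSimplex.

Lemma prismE n m s f g x : @prism n m s f g x = prism_fun s f g x.
Proof. by []. Qed.

Lemma eq_prism n m s f f' g g' : f =1 f' -> g =1 g' ->
  @prism n m s f g = prism s f' g'.
Proof. by move=> /funext-> /funext->. Qed.

Lemma face_prism n m s f g i :
  face i (@prism n.+1 m s f g) = prism s (f \o lift i) (g \o lift i).
Proof.
apply/continuousEP => x.
by rewrite [LHS]/(prism_fun s f g (face_map i x)) /prism_fun vertex_map_face sum_coord_face.
Qed.

Lemma prism_face n m s f g k :
  @prism n m (face k s) f g = prism s (lift k \o f) g.
Proof.
apply/continuousEP => x; rewrite !prismE /prism_fun -face_vertex_map.
by [].
Qed.

Hypothesis K0 : forall e, K (e, zero) = e.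

Lemma prism_bottom n (s : singular_simplex R E n) f g :
  f =1 id -> g =1 xpred0 -> prism s f g = s.
Proof.
move=> /(eq_prism _) fE /fE ->; apply/continuousEP => x.
by rewrite prismE /prism_fun big_pred0_eq vertex_map_id K0.
Qed.

Definition homotopy_end : continuousType E E :=
  continuous_fun (continuous_slice (t := one : I) cK).

Lemma prism_top n (s : singular_simplex R E n) f g :
  f =1 id -> g =1 xpredT -> prism s f g = (homotopy_end \o s : singular_simplex R E n).
Proof.
move=> /(eq_prism _) fE /fE ->; apply/continuousEP => x.
by rewrite prismE /prism_fun coord_sum vertex_map_id.
Qed.

Lemma prism_equivariant (D : continuousType E E) n m (s : singular_simplex R E m) f g :
  (forall e t, K (D e, t) = D (K (e, t))) ->
  @prism n m (D \o s : singular_simplex R E m) f g =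
    (D \o prism s f g : singular_simplex R E n).
Proof. by move=> DK; apply/continuousEP => x; exact: DK. Qed.

End Simplices.

(** * The chain homotopy of the lifted homotopy *)

Section Annihilation.
Variable R : realType.
Local Notation I := (unit_interval R).
Variables (E X : topologicalType) (p : E -> X) (e0 : E).
Variables (eps : pi1 R (p e0) -> int) (N : nat).
Variable gamma : pi1 R (p e0) -> 'M[int]_N.
Local Notation W := 'rV[laurent]_N.
Local Notation chain := (chain R E N).
Local Notation rel := (tensor_relation eps gamma).

Lemma tensor_relation_finite_support n (c : chain n) : rel c -> finite_support c.
Proof.
elim=> {c} [w g D s _||c d _ fc _ fd|c _ fc].
- apply: finite_supportD; first exact: finite_support_pure.
  exact/finite_supportN/finite_support_pure.
- exact: finite_support0.
- exact: finite_supportD.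
- exact: finite_supportN.
Qed.

(** An additive map that is compatible with the deck transformations descends to
    the tensor product over the group ring. *)
Lemma tensor_relation_extend n m
    (phi : singular_simplex R E n -> W -> chain m) :
  (forall s, {morph phi s : v w / v + w}) ->
  (forall w g (D : continuousType E E) s, deck_of g D ->
    rel (phi s (right_action eps gamma w g) - phi (D \o s : singular_simplex R E n) w)) ->
  forall c, rel c -> rel (extend phi c).
Proof.
move=> phiD phigen; have phi0 s : phi s 0 = 0 by apply: (addrI (phi s 0)); rewrite -phiD !addr0.
move=> c; elim=> {c} [w g D s gD||c d rc IHc rd IHd|c rc IHc].
- rewrite extendD ?extendN ?extend_pure //; first exact: phigen.
  + exact: finite_support_pure.
  + exact: finite_support_pure.
  + exact/finite_supportN/finite_support_pure.
- by rewrite extend0 //; exact: TensorRelation_zero.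
- rewrite extendD //; try exact: tensor_relation_finite_support.
  exact: TensorRelation_add.
- rewrite extendN //; last exact: tensor_relation_finite_support.
  exact: TensorRelation_opp.
Qed.

Lemma boundariesD n (c d : chain n) :
  boundaries eps gamma c -> boundaries eps gamma d -> boundaries eps gamma (c + d).
Proof.
move=> [b fb rb] [b' fb' rb']; exists (b + b'); first exact: finite_supportD.
rewrite differentialD // opprD addrACA; exact: TensorRelation_add.
Qed.

Lemma boundaries_rel n (c : chain n) : rel c -> boundaries eps gamma c.
Proof.
move=> rc; exists 0; first exact: finite_support0.
by rewrite differentialE extend0 ?subr0 //; exact: boundary_of0.
Qed.

Variables (K : E * I -> E) (cK : continuous K) (K0 : forall e, K (e, zero) = e).
Hypothesis KD : forall D : E -> E, continuous D -> p \o D =1 p ->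
  forall e t, K (D e, t) = D (K (e, t)).
Variable g : pi1 R (p e0).
Hypothesis deckK : deck_of g (homotopy_end cK).

Let deckKD (h : pi1 R (p e0)) (D : continuousType E E) : deck_of h D ->
  forall e t, K (D e, t) = D (K (e, t)).
Proof. by move=> [[[cD _] pD] _]; exact: KD. Qed.

(** The additive extension of [push] is the chain map that the end of the homotopy
    induces; those of [cylinder] and [prism_chain] are the prism operators on points
    and on edges. *)
Definition push n (s : singular_simplex R E n) (w : W) : chain n :=
  pure_tensor w (homotopy_end cK \o s : singular_simplex R E n).

Definition cylinder (s : singular_simplex R E 0) (w : W) : chain 1 :=
  pure_tensor w (prism cK s (fun=> ord0) (fun i : 'I_2 => (0 < i)%N)).

(** The triangulation of the prism over an edge with vertices 0 and 1 consists of
    the triangles on (bottom 0, top 0, top 1) and (bottom 0, bottom 1, top 1); the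
    map sends the three vertices of a triangle to the vertices below them. *)
Definition prism_vertex (k : nat) (i : 'I_3) : 'I_2 := inord (k <= i)%N.

Definition prism_chain (s : singular_simplex R E 1) (w : W) : chain 2 :=
  pure_tensor w (prism cK s (prism_vertex 2) (fun i : 'I_3 => (1 <= i)%N)) -
  pure_tensor w (prism cK s (prism_vertex 1) (fun i : 'I_3 => (2 <= i)%N)).

Lemma pushD n (s : singular_simplex R E n) : {morph push s : v w / v + w}.
Proof. by move=> v w; exact: pure_tensorD. Qed.

Lemma cylinderD s : {morph cylinder s : v w / v + w}.
Proof. by move=> v w; exact: pure_tensorD. Qed.

Lemma prism_chainD s : {morph prism_chain s : v w / v + w}.
Proof. by move=> v w; rewrite /prism_chain !pure_tensorD opprD addrACA. Qed.

Lemma push0 n (s : singular_simplex R E n) : push s 0 = 0.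
Proof. exact: pure_tensor0. Qed.

Lemma cylinder0 s : cylinder s 0 = 0. Proof. exact: pure_tensor0. Qed.

Lemma prism_chain0 s : prism_chain s 0 = 0.
Proof. by rewrite /prism_chain !pure_tensor0 subr0. Qed.

(** The diagonal is a face of both triangles and cancels; the top, the bottom and
    the two walls remain. *)
Lemma boundary_of_prism_chain (s : singular_simplex R E 1) (w : W) :
  differential (prism_chain s w) =
  push s w - pure_tensor w s - extend cylinder (boundary_of s w).
Proof.
rewrite /prism_chain differentialD; last 2 first.
- exact: finite_support_pure.
- exact/finite_supportN/finite_support_pure.
rewrite -pure_tensorN !differential_pure /boundary_of !big_ord_recl !big_ord0 !face_prism.
have i2 (P : 'I_2 -> Prop) : P ord0 -> P (lift ord0 ord0) -> forall i, P i.
  move=> P0 P1 [[|[|//]] ki]; [have -> : Ordinal ki = ord0 by exact: val_inj|].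
    by [].
  by have -> : Ordinal ki = lift ord0 ord0 by exact: val_inj.
have inord1 (b : bool) : inord b = (if b then lift ord0 ord0 else ord0) :> 'I_2.
  by case: b; apply: val_inj; rewrite /= inordK.
(* The six faces of the two triangles: the top, the bottom, twice the diagonal
   [side], and the walls over the two ends of [s]. *)
have top : prism cK s (prism_vertex 2 \o lift ord0)
    ((fun i : 'I_3 => (1 <= i)%N) \o lift ord0) = homotopy_end cK \o s.
  by apply: prism_top; apply: i2; rewrite //= /prism_vertex inord1.
have bottom : prism cK s (prism_vertex 1 \o lift (lift ord0 (lift ord0 ord0)))
    ((fun i : 'I_3 => (2 <= i)%N) \o lift (lift ord0 (lift ord0 ord0))) = s.
  by apply: prism_bottom => //; apply: i2; rewrite //= /prism_vertex inord1.
pose side := prism cK s id (fun i : 'I_2 => (0 < i)%N).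
have side1 : prism cK s (prism_vertex 2 \o lift (lift ord0 ord0))
    ((fun i : 'I_3 => (1 <= i)%N) \o lift (lift ord0 ord0)) = side.
  by apply: eq_prism; apply: i2; rewrite //= /prism_vertex inord1.
have side2 : prism cK s (prism_vertex 1 \o lift (lift ord0 ord0))
    ((fun i : 'I_3 => (2 <= i)%N) \o lift (lift ord0 ord0)) = side.
  by apply: eq_prism; apply: i2; rewrite //= /prism_vertex inord1.
have wall1 : prism cK s (prism_vertex 2 \o lift (lift ord0 (lift ord0 ord0)))
    ((fun i : 'I_3 => (1 <= i)%N) \o lift (lift ord0 (lift ord0 ord0))) =
  prism cK (face (lift ord0 ord0) s) (fun=> ord0) (fun i : 'I_2 => (0 < i)%N).
  by rewrite prism_face; apply: eq_prism; apply: i2;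
    rewrite //= /prism_vertex inord1 //; apply: val_inj.
have wall0 : prism cK s (prism_vertex 1 \o lift ord0)
    ((fun i : 'I_3 => (2 <= i)%N) \o lift ord0) =
  prism cK (face ord0 s) (fun=> ord0) (fun i : 'I_2 => (0 < i)%N).
  by rewrite prism_face; apply: eq_prism; apply: i2;
    rewrite //= /prism_vertex inord1 //; apply: val_inj.
rewrite top bottom side1 side2 wall1 wall0 !addr0 /=.
rewrite !expr0 !expr1 !scale1r !scaleN1r sqrrN expr1n !scale1r.
rewrite extendD; last 3 first.
- exact: cylinderD.
- exact: finite_support_pure.
- exact: finite_support_pure.
rewrite !extend_pure; try exact: cylinder0.
rewrite /push /cylinder !pure_tensorN !opprK.
set a := pure_tensor w (_ \o s).
move: a (pure_tensor w side) (pure_tensor w s) => a b e.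
set c := pure_tensor w _; set d := pure_tensor w _.
by rewrite opprB [- d + _]addrC [- b + c]addrC !addrA subrK [a + c - e]addrAC.
Qed.

Lemma extend_finite_support n m (phi : singular_simplex R E n -> W -> chain m) :
  (forall s, {morph phi s : v w / v + w}) ->
  (forall s w, finite_support (phi s w)) ->
  forall c, finite_support c -> finite_support (extend phi c).
Proof.
move=> phiD fphi; have phi0 s : phi s 0 = 0 by apply: (addrI (phi s 0)); rewrite -phiD !addr0.
apply: finite_support_ind; first by rewrite extend0 //; exact: finite_support0.
move=> w s c fc IHc; rewrite extendD //; last exact: finite_support_pure.
by apply: finite_supportD => //; rewrite extend_pure.
Qed.

Lemma finite_support_prism_chain s w : finite_support (prism_chain s w).
Proof.
apply: finite_supportD; first exact: finite_support_pure.
exact/finite_supportN/finite_support_pure.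
Qed.

Lemma finite_support_push n (c : chain n) :
  finite_support c -> finite_support (extend (@push n) c).
Proof.
move: c; apply: extend_finite_support => [|s w]; first exact: pushD.
exact: finite_support_pure.
Qed.

Lemma chain_homotopy (c : chain 1) : finite_support c ->
  differential (extend prism_chain c) =
  extend (@push 1) c - c - extend cylinder (differential c).
Proof.
move: c; apply: finite_support_ind.
  rewrite (extend0 prism_chain0) (extend0 (@push0 1)) !differentialE.
  rewrite !(extend0 (@boundary_of0 R E N _)) (extend0 cylinder0) !subr0.
  by [].
move=> w s c fc IHc; have fp := @finite_support_pure R E N 1 w s.
have fP d : finite_support d -> finite_support (extend prism_chain d).
  by apply: extend_finite_support; [exact: prism_chainD|exact: finite_support_prism_chain].
rewrite (extendD prism_chainD) // !differentialD //.
rewrite IHc (extend_pure _ _ prism_chain0) boundary_of_prism_chain.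
rewrite (extendD (@pushD 1)) // (extend_pure _ _ (@push0 1)).
rewrite (extendD cylinderD).
- by rewrite differential_pure !opprD [LHS]addrACA [X in X + _ = _]addrACA.
- exact: finite_support_differential.
- exact: finite_support_differential.
- exact: fP.
- exact: fP.
Qed.

Lemma push_differential n (c : chain n.+1) : finite_support c ->
  differential (extend (@push n.+1) c) = extend (@push n) (differential c).
Proof.
move: c; apply: finite_support_ind.
  rewrite (extend0 (@push0 n.+1)) !differentialE.
  by rewrite !(extend0 (@boundary_of0 R E N _)) (extend0 (@push0 n)).
move=> w s c fc IHc; have fp := @finite_support_pure R E N n.+1 w s.
have fe := finite_support_push fp; have fe' := finite_support_push fc.
have fd := finite_support_differential fp; have fd' := finite_support_differential fc.
rewrite (extendD (@pushD n.+1) fp fc) (differentialD fe fe') (differentialD fp fc).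
rewrite IHc (extendD (@pushD n) fd fd').
congr (_ + _); rewrite (extend_pure _ _ (@push0 n.+1)).
rewrite !differential_pure /boundary_of.
elim: (index_enum _) => [|i r IHr]; first by rewrite !big_nil (extend0 (@push0 n)).
have fi : finite_support (pure_tensor ((-1) ^+ i *: w) (face i s)).
  exact: finite_support_pure.
have fr : finite_support (\sum_(j <- r) pure_tensor ((-1) ^+ j *: w) (face j s)).
  by apply: finite_support_sum => j; exact: finite_support_pure.
rewrite !big_cons (extendD (@pushD n) fi fr).
rewrite (extend_pure _ _ (@push0 n)) IHr; congr (_ + _); congr (pure_tensor _ _).
exact/continuousEP.
Qed.

Lemma push_rel n (c : chain n) : rel c -> rel (extend (@push n) c).
Proof.
move: c; apply: tensor_relation_extend; first exact: pushD.
move=> w h D s hD; rewrite /push.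
have -> : homotopy_end cK \o (D \o s : singular_simplex R E n) =
    (D \o (homotopy_end cK \o s : singular_simplex R E n)) :> singular_simplex R E n.
  by apply/continuousEP => x; exact: deckKD hD _ _.
exact: TensorRelation_gen.
Qed.

Lemma cylinder_rel (c : chain 0) : rel c -> rel (extend cylinder c).
Proof.
move: c; apply: tensor_relation_extend; first exact: cylinderD.
move=> w h D s hD; rewrite /cylinder prism_equivariant; last exact: deckKD hD.
exact: TensorRelation_gen.
Qed.

Lemma push_cycle (c : chain 1) : cycles eps gamma c -> cycles eps gamma (extend (@push 1) c).
Proof.
move=> [fc rc]; split; first exact: finite_support_push.
by rewrite push_differential //; exact: push_rel.
Qed.

(** The prism operator descends to the tensor product, where the boundary of a
    cycle vanishes. *)
Lemma push_sub_boundary (c : chain 1) : cycles eps gamma c ->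
  boundaries eps gamma (extend (@push 1) c - c).
Proof.
move=> [fc rc]; exists (extend prism_chain c).
  apply: extend_finite_support => //; first exact: prism_chainD.
  exact: finite_support_prism_chain.
rewrite chain_homotopy // opprD addrA subrr sub0r opprK.
exact: cylinder_rel.
Qed.

(** A telescoping sum, since [push] maps cycles to cycles. *)
Lemma iter_push_sub_boundary (c : chain 1) k : cycles eps gamma c ->
  boundaries eps gamma (iter k (extend (@push 1)) c - c).
Proof.
move=> cc; elim: k => [|k IHk].
  by rewrite /= subrr; apply: boundaries_rel; exact: TensorRelation_zero.
have ck : cycles eps gamma (iter k (extend (@push 1)) c).
  by elim: (k) => //= m; exact: push_cycle.
rewrite -(subrKA (iter k (extend (@push 1)) c)) /=.
exact/boundariesD/IHk/push_sub_boundary.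
Qed.

Definition act_chain n (c : chain n) : chain n :=
  fun s => right_action eps gamma (c s) g.

Lemma right_actionD (v w : W) : right_action eps gamma (v + w) g =
  right_action eps gamma v g + right_action eps gamma w g.
Proof. by rewrite /right_action mulmxDl scalerDr. Qed.

Lemma right_action0 : right_action eps gamma 0 g = 0.
Proof. by rewrite /right_action mul0mx scaler0. Qed.

(** Moving the simplices of a chain by the deck transformation of [g] amounts, in
    the tensor product, to the action of [g] on the coefficients. *)
Lemma push_act_rel n (c : chain n) : finite_support c ->
  rel (extend (@push n) c - act_chain c).
Proof.
move: c; apply: finite_support_ind.
  rewrite extend0; last exact: push0.
  have -> : act_chain (0 : chain n) = 0 by apply/funext => s; exact: right_action0.
  by rewrite subrr; exact: TensorRelation_zero.
move=> w s c fc IHc; rewrite (extendD (@pushD n)) //; last exact: finite_support_pure.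
have -> : act_chain (pure_tensor w s + c) =
    pure_tensor (right_action eps gamma w g) s + act_chain c.
  apply/funext => s'; rewrite chainD /act_chain chainD right_actionD.
  by congr (_ + _); rewrite /pure_tensor; case: eqP => // _; exact: right_action0.
rewrite opprD addrACA; apply: TensorRelation_add IHc.
rewrite extend_pure; last exact: push0.
by rewrite -opprB; apply: TensorRelation_opp; exact: TensorRelation_gen.
Qed.

Lemma finite_support_act n (c : chain n) :
  finite_support c -> finite_support (act_chain c).
Proof.
move=> /finite_supportP[r rP]; apply/finite_supportP; exists r => s /rP cs.
by rewrite /act_chain cs right_action0.
Qed.

Lemma iter_push_act_rel n (c : chain n) k : finite_support c ->
  rel (iter k (extend (@push n)) c - iter k (@act_chain n) c).
Proof.
move=> fc; elim: k => [|k IHk]; first by rewrite subrr; exact: TensorRelation_zero.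
have fa : finite_support (iter k (@act_chain n) c).
  by elim: (k) => //= m; exact: finite_support_act.
have fp : finite_support (iter k (extend (@push n)) c).
  by elim: (k) => //= m; exact: finite_support_push.
rewrite -(subrKA (extend (@push n) (iter k (@act_chain n) c))) /=.
apply: TensorRelation_add; last exact: push_act_rel.
rewrite -(extendN (@pushD n)) // -(extendD (@pushD n)) //; last exact: finite_supportN.
exact: push_rel.
Qed.

End Annihilation.

Lemma perm_mx_finite_order (L : pzRingType) (N : nat) (A : 'M[L]_N) : is_perm_mx A ->
  exists2 k, (0 < k)%N & forall w : 'rV[L]_N, iter k (mulmxr A) w = w.
Proof.
move=> /is_perm_mxP[s ->]; exists #[s]%g => [|w]; first exact: order_gt0.
have iterE k : iter k (mulmxr (perm_mx s)) w = w *m perm_mx (s ^+ k)%g.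
  elim: k => [|k IHk] /=; first by rewrite expg0 perm_mx1 mulmx1.
  by rewrite IHk expgSr perm_mxM mulmxA.
by rewrite iterE expg_order perm_mx1 mulmx1.
Qed.

(** The end of the lifted homotopy is a deck transformation that is chain
    homotopic to the identity, and that acts in the tensor product as [g]. Some
    power of [g] acts on them as a power of [t], because [gamma] has finite
    order at [g]. *)
Theorem identity_homotopy_annihilates (R : realType) (E X : topologicalType)
    (p : E -> X) (e0 : E) (eps : pi1 R (p e0) -> int) (N : nat)
    (gamma : pi1 R (p e0) -> 'M[int]_N)
    (H : X * unit_interval R -> X) (cH : continuous H)
    (H0 : forall x, H (x, zero) = x) (H1 : forall x, H (x, one) = x) :
  covering_map p -> (forall x, is_perm_mx (gamma x)) ->
  exists2 k, (0 < k)%N & forall c, cycles eps gamma (n := 0) c ->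
    boundaries eps gamma
      ((tpow (k%:Z * eps (loop_class (trace cH H0 H1 (p e0)))) - 1) *: c).
Proof.
move=> covp gammaP; set g := loop_class _.
have [K [cK K0 pK KD]] := identity_homotopy_lift covp cH H0.
have deckK : deck_of g (homotopy_end cK) by exact: (identity_homotopy_deck covp).
have [|k k0 kP] := @perm_mx_finite_order laurent N (map_mx intr (gamma g)).
  by have /is_perm_mxP[s ->] := gammaP g; rewrite map_perm_mx perm_mx_is_perm.
exists k => // c cc; rewrite scalerBl scale1r.
have fc : Defs.finite_support c by case: cc.
have actE w : iter k (fun v => right_action eps gamma v g) w = tpow (k%:Z * eps g) *: w.
  have iterE m : iter m (fun v => right_action eps gamma v g) w =
      tpow (m%:Z * eps g) *: iter m (mulmxr (map_mx intr (gamma g))) w.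
    elim: m => [|m IHm] /=; first by rewrite mul0r tpow0 scale1r.
    rewrite IHm /right_action -scalemxAl scalerA -tpowD.
    by rewrite intS mulrDl mul1r.
  by rewrite iterE kP.
have actcE : iter k (@act_chain R E X p e0 eps N gamma g 1) c = tpow (k%:Z * eps g) *: c.
  apply/funext => s; rewrite chainZ -actE.
  by elim: (k) => //= m <-.
have rk := iter_push_act_rel eps gamma KD deckK k fc.
have bk := iter_push_sub_boundary cK K0 KD k cc.
rewrite -(subrKA (iter k (extend (push cK (n:=1))) c)).
apply: boundariesD bk; apply: boundaries_rel.
by rewrite -actcE -opprB; exact: TensorRelation_opp.
Qed.

(** * The circle and winding numbers *)

Section Circle.
Variable R : realType.
Local Notation I := (unit_interval R).

Lemma circle_point_subproof (a : R) : cis 1 a \in [set z : R * R | sqnorm z = 1].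
Proof. by rewrite inE /sqnorm /= !mul1r cos2Dsin2. Qed.

(** The covering of the circle by the line, in radians. *)
Definition circ (a : R) : sphere1 R :=
  exist (fun z => z \in [set z : R * R | sqnorm z = 1]) _ (circle_point_subproof a).

Lemma circ_val a : set_val (circ a) = (cos a, sin a).
Proof. by rewrite -[LHS]/(cis 1 a) /cis !mul1r. Qed.

Lemma sphere1_eq (u v : sphere1 R) : set_val u = set_val v -> u = v.
Proof. exact: val_inj. Qed.

Lemma sphere1P (u : sphere1 R) : sqnorm (set_val u) = 1.
Proof. by have := valP u; rewrite inE. Qed.

Lemma circ_eq a b : circ a = circ b <-> cos a = cos b /\ sin a = sin b.
Proof.
split=> [/(congr1 set_val)|[ca sa]]; first by rewrite !circ_val => -[].
by apply: sphere1_eq; rewrite !circ_val ca sa.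
Qed.

Lemma circD a b x : circ a = circ b -> circ (a + x) = circ (b + x).
Proof. by move=> /circ_eq[ca sa]; apply/circ_eq; rewrite !cosD !sinD ca sa. Qed.

Lemma circ_sub a b : circ a = circ b -> circ (a - b) = circ 0.
Proof. by move=> /(circD (- b)); rewrite subrr. Qed.

Lemma circ_period d x : circ d = circ 0 -> circ (x + d) = circ x.
Proof. by move=> /(circD x); rewrite add0r addrC. Qed.

Lemma continuous_into_sphere1 (Y : topologicalType) (f : Y -> sphere1 R) :
  continuous (fun y => set_val (f y)) -> continuous f.
Proof. by move=> cf; exact: continuous_comp_initial. Qed.

Lemma continuous_sphere1_val : continuous (set_val : sphere1 R -> R * R).
Proof. exact: initial_continuous. Qed.

Lemma continuous_circ : continuous circ.
Proof.
apply: continuous_into_sphere1.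
under eq_fun do rewrite circ_val.
by apply: continuous_pair; [exact: continuous_cos|exact: continuous_sin].
Qed.

Lemma sqr_le1 (x : R) : x ^+ 2 <= 1 -> -1 <= x <= 1.
Proof.
by move=> x2; rewrite -ler_norml -(expr_le1 (n := 2)) // real_normK // num_real.
Qed.

Lemma circ_surj_pi (u : sphere1 R) : exists2 a, - pi <= a <= pi & circ a = u.
Proof.
have := sphere1P u; case uE : (set_val u) => [x y]; rewrite /sqnorm /= => xy1.
have x1 : -1 <= x <= 1 by apply: sqr_le1; have := sqr_ge0 y; lra.
have y2 : 1 - x ^+ 2 = y ^+ 2 by lra.
have cx : cos (acos x) = x by rewrite acosK // in_itv.
have sx : sin (acos x) = `|y| by rewrite sin_acos // y2 sqrtr_sqr.
have [a0 api] : 0 <= acos x /\ acos x <= pi by rewrite acos_ge0 ?acos_lepi.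
have [y0|y0] := lerP 0 y.
  exists (acos x); first by rewrite api andbT; lra.
  by apply: sphere1_eq; rewrite circ_val uE cx sx ger0_norm.
exists (- acos x); first by rewrite lerN2 api /=; lra.
by apply: sphere1_eq; rewrite circ_val uE cosN sinN cx sx ltr0_norm // opprK.
Qed.

Lemma circ_surj (u : sphere1 R) : exists a, circ a = u.
Proof. by have [a _ <-] := circ_surj_pi u; exists a. Qed.

(** On the half circle of positive cosine, the argument is the arc tangent of the
    slope. *)
Lemma circ_atan b : 0 < cos b -> circ (atan (sin b / cos b)) = circ b.
Proof.
move=> cb; have cb0 : cos b != 0 by rewrite gt_eqF.
have ca : cos (atan (sin b / cos b)) = cos b.
  rewrite cos_atan -[sin b / cos b]/(tan b) -cos2_tan2 //.
  by rewrite -exprVn sqrtr_sqr gtr0_norm ?invr_gt0 // invrK.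
apply/circ_eq; split=> //.
have := atanK (sin b / cos b); rewrite /tan ca.
by move=> /(congr1 ( *%R^~ (cos b))); rewrite !divfK.
Qed.

Lemma circ_inj a b : circ a = circ b -> `|a - b| < pi -> a = b.
Proof.
move=> /circ_sub /circ_eq[]; rewrite cos0 sin0 => cab _ ab.
have : `|a - b| = 0.
  apply: (@cos_inj R); rewrite ?in_itv /= ?normr_ge0 ?lexx ?pi_ge0 ?ltW //.
  by rewrite cos_norm cab cos0.
by move/eqP; rewrite normr_eq0 subr_eq0 => /eqP.
Qed.

(** The cosine and the sine of the angle from [u] to [v]. *)
Definition inner (u v : sphere1 R) : R :=
  (set_val u).1 * (set_val v).1 + (set_val u).2 * (set_val v).2.
Definition area (u v : sphere1 R) : R :=
  (set_val u).1 * (set_val v).2 - (set_val u).2 * (set_val v).1.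

Lemma inner_circ a b : inner (circ a) (circ b) = cos (b - a).
Proof. by rewrite /inner !circ_val /= cosB; ring. Qed.

Lemma area_circ a b : area (circ a) (circ b) = sin (b - a).
Proof. by rewrite /area !circ_val /= sinB; ring. Qed.

Let continuous_coord1 : continuous (fun v : sphere1 R => (set_val v).1).
Proof. exact: (continuous_compo continuous_sphere1_val (@fst_continuous _ _)). Qed.

Let continuous_coord2 : continuous (fun v : sphere1 R => (set_val v).2).
Proof. exact: (continuous_compo continuous_sphere1_val (@snd_continuous _ _)). Qed.

Lemma continuous_inner u : continuous (inner u).
Proof.
apply: continuous_addr; apply: continuous_mulr => //; exact: cst_continuous.
Qed.

Lemma continuous_area u : continuous (area u).
Proof.
have -> : area u = (fun v => (set_val u).1 * (set_val v).2 + - (set_val u).2 * (set_val v).1).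
  by apply/funext => v; rewrite /area mulNr.
apply: continuous_addr; apply: continuous_mulr => //; exact: cst_continuous.
Qed.

(** Over the open half circle centred at [u0], the sheets are the intervals of
    length [pi] centred at the arguments [c] of [u0]. *)
Lemma covering_circ : covering_map circ.
Proof.
split; first exact: continuous_circ.
  exact: circ_surj.
move=> u0; exists [set u | 0 < inner u0 u].
have [a0 <-] := circ_surj u0.
have sheet_inner c a : circ c = circ a0 -> inner (circ a0) (circ a) = cos (a - c).
  by move=> <-; rewrite inner_circ.
have cos_sheet c a : `|a - c| < pi / 2 -> 0 < cos (a - c).
  by move=> ac; apply: cos_gt0_pihalf; rewrite -ltr_norml.
split.
- apply: (@open_comp _ _ (inner (circ a0)) [set x | 0 < x]); last exact: open_gt.
  by move=> u _; exact: continuous_inner.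
- by rewrite /= inner_circ subrr cos0.
exists [set V | exists2 c, circ c = circ a0 & V = [set a | `|a - c| < pi / 2]].
split.
- move=> _ [c _ ->].
  apply: (@open_comp _ _ (fun a : R => `|a - c|) [set x | x < pi / 2]); last exact: open_lt.
  move=> a _; apply: (@continuous_comp _ _ _ (fun a : R => a - c) Num.norm).
    by apply: cvgB; [exact: cvg_id|exact: cvg_cst].
  exact: norm_continuous.
- move=> _ _ [c cE ->] [c' c'E ->] [a /= [ac ac']].
  have -> : c = c'; last by [].
  apply: circ_inj; first by rewrite cE.
  have := ler_distD a c c'; rewrite [`|c - a|]distrC => /le_lt_trans; apply.
  by rewrite [X in _ < X]splitr ltrD.
- apply/seteqP; split=> [a /=|a [_ [c cE ->] /= ac]]; last first.
    by rewrite (sheet_inner c) //; exact: cos_sheet.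
  rewrite inner_circ => ca.
  have atE := circ_atan ca; set b := atan _ in atE.
  exists [set a' | `|a' - (a - b)| < pi / 2].
    exists (a - b) => //.
    have -> : a - b = (a - a0) + (a0 - b) by ring.
    by rewrite -(circD _ atE); congr circ; ring.
  by rewrite /= opprB addrC subrK ltr_norml atan_gtNpi2 atan_ltpi2.
- move=> _ [c cE ->]; exists (fun u => c + atan (area (circ c) u / inner (circ c) u)).
  have innerE u : inner (circ a0) u = inner (circ c) u by rewrite cE.
  split.
  + rewrite continuous_open_subspace; last first.
      apply: (@open_comp _ _ (inner (circ a0)) [set x | 0 < x]); last exact: open_gt.
      by move=> u _; exact: continuous_inner.
    move=> u; rewrite inE /= innerE => iu.
    apply: (@continuous_comp _ _ _ (fun u => area (circ c) u / inner (circ c) u)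
      (fun r : R => c + atan r)).
      apply: continuous_atM; first exact: continuous_area.
      apply: continuous_atV; first exact: continuous_inner.
      by rewrite gt_eqF.
    apply: (continuous_addr (f := cst c)); first exact: cst_continuous.
    by move=> r; exact: continuous_atan.
  + move=> u /=; rewrite innerE; have [a <-] := circ_surj u.
    rewrite inner_circ area_circ => ca; split.
      by rewrite /= addrC addKr ltr_norml atan_gtNpi2 atan_ltpi2.
    have := circD c (circ_atan ca); rewrite [_ + c]addrC => ->.
    by rewrite subrK.
  + move=> a /= ac; rewrite inner_circ area_circ -[sin _ / cos _]/(tan _).
    by rewrite tanK ?in_itv /= -?ltr_norml // addrC subrK.
Qed.

End Circle.

Section Winding.
Variable R : realType.
Local Notation I := (unit_interval R).

(** The total variation of the argument along [u], in radians: a multiple of a full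
    turn if [u] is a loop. *)
Definition winding (u : I -> sphere1 R) (r : R) : Prop :=
  exists theta : I -> R,
    [/\ continuous theta, forall t, circ (theta t) = u t & r = theta one - theta zero].

Lemma winding_exists (u : I -> sphere1 R) : continuous u -> exists r, winding u r.
Proof.
move=> cu; have [a0 a0E] := circ_surj (u zero).
have cG : continuous (fun z : I * I => u z.2).
  exact: (continuous_compo (@snd_continuous _ _) cu).
have [|y|K [cK KE K0]] := homotopy_lifting (@covering_circ R) cG (g0 := cst a0).
- exact: cst_continuous.
- by rewrite /= a0E.
exists (K (zero, one) - K (zero, zero)), (fun t => K (zero, t)); split => //.
exact: continuous_line.
Qed.

Lemma angle_unique (v w : I -> R) : continuous v -> continuous w ->
  (forall t, circ (v t) = circ (w t)) -> v zero = w zero -> forall t, v t = w t.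
Proof.
by move=> cv cw vw vw0; exact: (lift_unique (@covering_circ R) (@connected_unit_interval R) cv cw vw vw0).
Qed.

(** The two ends of the homotopy may move, as long as they remain equal: their
    arguments then differ by a constant multiple of a full turn. *)
Lemma winding_homotopy (F : I * I -> sphere1 R) r : continuous F ->
  (forall t, F (zero, t) = F (one, t)) ->
  winding (fun s => F (s, zero)) r -> winding (fun s => F (s, one)) r.
Proof.
move=> cF F01 [theta [ctheta thetaE rE]].
have [K [cK KE K0]] := homotopy_lifting (@covering_circ R) cF ctheta thetaE.
exists (fun s => K (s, one)); split; first exact: continuous_slice.
  by move=> t; rewrite KE.
pose d := theta one - theta zero.
have d0 : circ d = circ 0 by apply: circ_sub; rewrite !thetaE F01.
have -> : K (one, one) = K (zero, one) + d; last by rewrite rE /d; ring.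
apply: (angle_unique (v := fun t => K (one, t)) (w := fun t => K (zero, t) + d)).
- exact: continuous_line.
- by apply: continuous_addr; [exact: continuous_line|exact: cst_continuous].
- by move=> t; rewrite circ_period // !KE F01.
- by rewrite !K0 /d; ring.
Qed.

Lemma winding_unique (u : I -> sphere1 R) r r' :
  winding u r -> winding u r' -> r = r'.
Proof.
move=> [th [cth thE ->]] [th' [cth' th'E ->]].
pose d := th zero - th' zero.
have d0 : circ d = circ 0 by apply: circ_sub; rewrite thE th'E.
have -> : th one = th' one + d; last by rewrite /d; ring.
apply: (angle_unique (v := th) (w := fun t => th' t + d)) => //.
- by apply: continuous_addr => //; exact: cst_continuous.
- by move=> t; rewrite circ_period // thE th'E.
- by rewrite /d; ring.
Qed.

Variables (X : topologicalType) (f : X -> sphere1 R) (x : X).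
Hypothesis cf : continuous f.
Local Notation loop := {path I from x to x}.

Lemma continuous_along (l : loop) : continuous (f \o l).
Proof. exact: (continuous_compo (@cts_fun _ _ l) cf). Qed.

Lemma winding_concat (l l' : loop) r r' :
  winding (f \o l) r -> winding (f \o l') r' -> winding (f \o concat l l') (r + r').
Proof.
move=> [th [cth thE ->]] [th' [cth' th'E ->]].
pose d := th one - th' zero.
have d0 : circ d = circ 0.
  by apply: circ_sub; rewrite thE th'E /= path_one path_zero.
have cthd : continuous (fun t => th' t + d).
  by apply: continuous_addr => //; exact: cst_continuous.
have th'0 : th' zero + d = th one by rewrite /d; ring.
pose q : {path I from th zero to th one} := mk_path cth erefl erefl.
pose q' : {path I from th one to th' one + d} := mk_path cthd th'0 erefl.
exists (concat q q'); split.
- exact: cts_fun.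
- move=> t; rewrite /= /mk_path /concat_fun.
  case: ifP => _; first exact: thE.
  by rewrite /= /mk_path circ_period.
- by rewrite path_one path_zero /d; ring.
Qed.

Lemma winding_homotopic (l l' : loop) r :
  homotopic l l' -> winding (f \o l) r -> winding (f \o l') r.
Proof.
move=> [H [cH H0 H1 Hx Hy]] [th [cth thE rE]].
have cfH : continuous (fun z => f (H z)) := continuous_compo cH cf.
have [||th' [cth' th'E r'E]] := @winding_homotopy (fun z => f (H z)) r cfH.
- by move=> t; rewrite Hx Hy.
- by exists th; split => // t; rewrite H0 thE.
by exists th'; split => // t; rewrite th'E H1.
Qed.

Let phi_subproof (a : pi1 R x) : exists r, winding (f \o repr a) r.
Proof. exact/winding_exists/continuous_along. Qed.

Definition winding_number (a : pi1 R x) : R := sval (cid (phi_subproof a)).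

Lemma winding_number_class (l : loop) : winding (f \o l) (winding_number (loop_class l)).
Proof.
rewrite /winding_number; case: cid => r /= rP.
exact: winding_homotopic (repr_loop_class l) rP.
Qed.

Lemma winding_numberM (a b : pi1 R x) :
  winding_number (a * b)%g = winding_number a + winding_number b.
Proof.
have := winding_number_class (concat (repr a) (repr b)).
rewrite -pi1_mulE !loop_class_repr => ab.
have := winding_concat (winding_number_class (repr a)) (winding_number_class (repr b)).
by rewrite !loop_class_repr; exact: winding_unique ab.
Qed.

(** Winding numbers are additive, and therefore vanish on commutators. *)
Lemma winding_number_commutator (a : pi1 R x) :
  commutator_subgroup a -> winding_number a = 0.
Proof.
have w1 : winding_number 1%g = 0.
  by apply: (addrI (winding_number 1%g)); rewrite -winding_numberM mulg1 addr0.
have wV b : winding_number b^-1%g = - winding_number b.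
  by apply/eqP; rewrite -addr_eq0 -winding_numberM mulVg w1.
elim=> {a} [//|a b|a b _ wa _ wb|a _ wa].
- by rewrite commgEl conjgE !winding_numberM !wV; ring.
- by rewrite winding_numberM wa wb addr0.
- by rewrite wV wa oppr0.
Qed.

End Winding.

(** * Pushing the complement of a knot into its exterior *)

Lemma injective_hausdorff (S T : topologicalType) (f : S -> T) :
  continuous f -> injective f -> hausdorff_space T -> hausdorff_space S.
Proof.
move=> cf fI hT x y xy; apply/fI/hT => A B nA nB.
have nA' : nbhs x (f @^-1` A) by exact: cf.
have nB' : nbhs y (f @^-1` B) by exact: cf.
by have [z [Az Bz]] := xy _ _ nA' nB'; exists (f z).
Qed.

Lemma sphere3_hausdorff (R : realType) : hausdorff_space (sphere3 R).
Proof.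
apply: (@injective_hausdorff (sphere3 R) ((R * R) * (R * R))%type set_val).
- exact: initial_continuous.
- exact: val_inj.
- exact: (@norm_hausdorff R ((R * R) * (R * R))%type).
Qed.

Section SquareNorm.
Variable R : realType.
Implicit Types v : R * R.

Lemma sqnorm_ge0 v : 0 <= sqnorm v.
Proof. by rewrite addr_ge0 ?sqr_ge0. Qed.

Lemma sqnorm_eq0 v : sqnorm v = 0 -> v = (0, 0).
Proof.
case: v => x y /eqP; rewrite /sqnorm /= paddr_eq0 ?sqr_ge0 // !sqrf_eq0.
by move=> /andP[/eqP-> /eqP->].
Qed.

Lemma sqnorm_gt0 v : v <> (0, 0) -> 0 < sqnorm v.
Proof.
by move=> v0; rewrite lt_neqAle sqnorm_ge0 andbT; apply/eqP => /esym/sqnorm_eq0.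
Qed.

Definition scale (m : R) v : R * R := (m * v.1, m * v.2).

Lemma sqnorm_scale m v : sqnorm (scale m v) = m ^+ 2 * sqnorm v.
Proof. by rewrite /sqnorm /=; ring. Qed.

Lemma scale1 v : scale 1 v = v.
Proof. by case: v => x y; rewrite /scale !mul1r. Qed.

Lemma continuous_sqnorm : continuous (@sqnorm R).
Proof.
have c1 : continuous (fun v : R * R => v.1) := @fst_continuous R R.
have c2 : continuous (fun v : R * R => v.2) := @snd_continuous R R.
by apply: continuous_addr => v; apply: cvgM; [exact: c1|exact: c1|exact: c2|exact: c2].
Qed.

End SquareNorm.

Section Retraction.
Variables (R : realType) (tau : sphere1 R * (R * R) -> sphere3 R).
Hypotheses (ctau : continuous tau) (tauI : injective tau).
Hypothesis tau_open : forall O, open O -> open (tau @` O).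
Local Notation k := (tau @` [set y | y.2 = (0, 0)]).

(** At the time [s = 1] the factor moves the nonzero vectors of norm less
    than [1] radially to the unit circle; longer vectors never move. *)
Definition push_factor (s : R) (v : R * R) : R :=
  1 + s * (Num.max 1 (Num.sqrt (sqnorm v))^-1 - 1).

Definition push_out (s : R) (y : sphere1 R * (R * R)) : sphere1 R * (R * R) :=
  (y.1, scale (push_factor s y.2) y.2).

Lemma push_factor_ge1 s v : 0 <= s -> 1 <= push_factor s v.
Proof. by move=> s0; rewrite lerDl mulr_ge0 // subr_ge0 le_max lexx. Qed.

Lemma push_out0 y : push_out 0 y = y.
Proof. by case: y => u v; rewrite /push_out /push_factor mul0r addr0 scale1. Qed.

Lemma push_out_far s y : 1 <= sqnorm y.2 -> push_out s y = y.
Proof.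
case: y => u v /= v1; rewrite /push_out /push_factor /= max_l ?subrr ?mulr0 ?addr0 ?scale1 //.
by rewrite invf_le1 ?sqrtr_gt0 ?(lt_le_trans ltr01) // -sqrtr1 ler_wsqrtr.
Qed.

Lemma push_out_neq0 s y : 0 <= s -> y.2 <> (0, 0) -> (push_out s y).2 <> (0, 0).
Proof.
move=> s0 /sqnorm_gt0 y0 /(congr1 (@sqnorm R)); rewrite sqnorm_scale.
have f1 := push_factor_ge1 y.2 s0.
rewrite {2}/sqnorm /= expr0n /= addr0 => /eqP; rewrite mulf_eq0 sqrf_eq0.
by rewrite !gt_eqF // (lt_le_trans ltr01).
Qed.

Lemma push_out1_ge1 y : y.2 <> (0, 0) -> 1 <= sqnorm (push_out 1 y).2.
Proof.
move=> /sqnorm_gt0 y0; rewrite sqnorm_scale /push_factor mul1r addrC subrK.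
set n := Num.sqrt (sqnorm y.2).
have n0 : 0 < n by rewrite sqrtr_gt0.
have -> : sqnorm y.2 = n ^+ 2 by rewrite sqr_sqrtr // sqnorm_ge0.
rewrite -exprMn expr_ge1 ?mulr_ge0 ?le_max ?ler01 ?(ltW n0) //.
by rewrite -(mulVf (lt0r_neq0 n0)) ler_wpM2r ?(ltW n0) // le_max lexx orbT.
Qed.

Lemma continuous_push_out s y : y.2 <> (0, 0) ->
  {for (s, y), continuous (fun z : R * (sphere1 R * (R * R)) => push_out z.1 z.2)}.
Proof.
move=> y0.
pose n (z : R * (sphere1 R * (R * R))) := Num.sqrt (sqnorm z.2.2).
have c22 : continuous (fun z : R * (sphere1 R * (R * R)) => z.2.2).
  exact: (continuous_compo (@snd_continuous _ _) (@snd_continuous _ _)).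
have cn : continuous n.
  apply: (continuous_compo _ (@sqrt_continuous R)).
  exact: (continuous_compo c22 (@continuous_sqnorm R)).
have c1 : continuous (fun z : R * (sphere1 R * (R * R)) => z.1) := @fst_continuous _ _.
have nV : {for (s, y), continuous (fun z => (n z)^-1)}.
  apply: continuous_atV; first exact: cn.
  by rewrite gt_eqF // sqrtr_gt0; exact: sqnorm_gt0.
have cmax : continuous (fun r : R => Num.max 1 r - 1).
  apply: (continuous_addr (g := cst (-1))); last exact: cst_continuous.
  by apply: continuous_maxr; [exact: cst_continuous|move=> r; exact: cvg_id].
have cm : {for (s, y), continuous (fun z : R * (sphere1 R * (R * R)) => push_factor z.1 z.2.2)}.
  apply: continuous_atD; first exact: cst_continuous.
  apply: continuous_atM; first exact: c1.
  apply: (@continuous_comp _ _ _ (fun z => (n z)^-1) (fun r : R => Num.max 1 r - 1)) => //.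
  exact: cmax.
have c221 : continuous (fun z : R * (sphere1 R * (R * R)) => z.2.2.1).
  exact: (continuous_compo c22 (@fst_continuous _ _)).
have c222 : continuous (fun z : R * (sphere1 R * (R * R)) => z.2.2.2).
  exact: (continuous_compo c22 (@snd_continuous _ _)).
apply: continuous_at_pair.
  exact: (continuous_compo (@snd_continuous _ _) (@fst_continuous _ _)).
apply: continuous_at_pair; apply: continuous_atM.
- exact: cm.
- exact: c221.
- exact: cm.
- exact: c222.
Qed.

(** The unit square bundle is compact, hence closed in the sphere; outside it
    nothing moves. *)
Lemma closed_square_bundle :
  closed (tau @` [set y | -1 <= y.2.1 <= 1 /\ -1 <= y.2.2 <= 1]).
Proof.
have -> : tau @` [set y | -1 <= y.2.1 <= 1 /\ -1 <= y.2.2 <= 1] =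
    (fun z : R * (R * R) => tau (circ z.1, z.2)) @`
      (`[- pi, pi]%classic `*` (`[-1, 1]%classic `*` `[-1, 1]%classic)).
  apply/seteqP; split=> z [].
    move=> [u v] /= [v1 v2] <-; have [a aP <-] := circ_surj_pi u.
    by exists (a, v) => //=; rewrite !in_itv.
  by move=> [a v] /= [_ []]; rewrite !in_itv /= => v1 v2 <-; exists (circ a, v).
apply: compact_closed; first exact: sphere3_hausdorff.
apply: continuous_compact.
  apply: continuous_subspaceT; apply: (continuous_compo _ ctau).
  apply: continuous_pair; last exact: snd_continuous.
  exact: (continuous_compo (@fst_continuous _ _) (@continuous_circ R)).
by apply: compact_setX; [|apply: compact_setX]; exact: segment_compact.
Qed.

(** The deformation at the time [s], extended by the identity outside the tubular
    neighbourhood; it is continuous only off the knot. *)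
Definition retract (s : R) (z : sphere3 R) : sphere3 R :=
  if pselect (exists y, tau y = z) is left h then tau (push_out s (sval (cid h))) else z.

Lemma retract_tau s y : retract s (tau y) = tau (push_out s y).
Proof.
rewrite /retract; case: pselect => [h|]; last by case; exists y.
by case: cid => y' /= /tauI ->.
Qed.

Lemma retract_out s z : ~ (exists y, tau y = z) -> retract s z = z.
Proof. by move=> nz; rewrite /retract; case: pselect. Qed.

Lemma retract0 z : retract 0 z = z.
Proof.
have [[y <-]|/retract_out //] := pselect (exists y, tau y = z).
by rewrite retract_tau push_out0.
Qed.

Lemma retract_exterior s z : exterior tau z -> retract s z = z.
Proof.
have [[y <-]|/retract_out //] := pselect (exists y, tau y = z).
move=> yE; rewrite retract_tau push_out_far // leNgt; apply/negP => y1.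
by apply: yE; exists y.
Qed.

Lemma retract_avoids s z : 0 <= s -> ~ k z -> ~ k (retract s z).
Proof.
move=> s0; have [[y <-] kz|/[dup] nz /retract_out ->//] := pselect (exists y, tau y = z).
rewrite retract_tau => -[y' y'0 /tauI y'E].
have y0 : y.2 <> (0, 0) by move=> y0; apply: kz; exists y.
by apply: (push_out_neq0 s0 y0); rewrite -y'E.
Qed.

Lemma retract1 z : ~ k z -> exterior tau (retract 1 z).
Proof.
have [[y <-] kz|nz kz] := pselect (exists y, tau y = z).
  rewrite retract_tau => -[y' /= y'1 /tauI y'E].
  have y0 : y.2 <> (0, 0) by move=> y0; apply: kz; exists y.
  by move: y'1; rewrite y'E ltNge push_out1_ge1.
by rewrite retract_out // => -[y _ yz]; apply: nz; exists y.
Qed.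

(** At a point of the tubular neighbourhood, [tau] is a local homeomorphism and
    the deformation is [push_out] in its coordinates. All other points have a
    neighbourhood that the closed square bundle does not meet, where nothing
    moves. *)
Lemma continuous_retract (Y : topologicalType) (s : Y -> R) (c : Y -> sphere3 R) :
  continuous s -> continuous c -> (forall y, ~ k (c y)) ->
  continuous (fun y => retract (s y) (c y)).
Proof.
move=> cs cc ck y0.
have [[x0 x0E]|nx0] := pselect (exists x, tau x = c y0).
  have x02 : x0.2 <> (0, 0) by move=> x00; apply: (ck y0); exists x0.
  move=> U; rewrite nbhs_filterE -x0E retract_tau => nU.
  have [[A B] /= [nA nB] AB] : nbhs (s y0, x0)
      [set z : R * (sphere1 R * (R * R)) | U (tau (push_out z.1 z.2))].
    have ct : {for (s y0, x0), continuous
        (fun z : R * (sphere1 R * (R * R)) => tau (push_out z.1 z.2))}.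
      apply: (@continuous_comp _ _ _
        (fun z : R * (sphere1 R * (R * R)) => push_out z.1 z.2) tau).
        exact: continuous_push_out.
      exact: ctau.
    exact: ct.
  have nsA : nbhs y0 (s @^-1` A) by exact: cs.
  have ncB : nbhs y0 (c @^-1` (tau @` B°)).
    apply: cc; apply: open_nbhs_nbhs; split; first exact/tau_open/open_interior.
    by exists x0.
  apply: filterS (filterI nsA ncB) => y [/= As [x /interior_subset Bx xE]].
  by rewrite /preimage /= -xE retract_tau; exact: (AB (s y, x)).
apply: (@near_eq_continuous_at _ _ c); last exact: cc.
have := @closed_square_bundle; rewrite -openC => oK.
have nK : nbhs y0 (c @^-1` ~` (tau @` [set y | -1 <= y.2.1 <= 1 /\ -1 <= y.2.2 <= 1])).
  apply: cc; apply: open_nbhs_nbhs; split => // -[x _ xE].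
  by apply: nx0; exists x.
apply: filterS nK => y /= yK.
have [[x xE]|/retract_out ->//] := pselect (exists x, tau x = c y).
rewrite -xE retract_tau push_out_far // leNgt; apply/negP => x1.
have [n1 n2] := (sqr_ge0 x.2.1, sqr_ge0 x.2.2); rewrite /sqnorm in x1.
by apply: yK; exists x => //; split; apply: sqr_le1; lra.
Qed.

End Retraction.

(** * The circle action on the complement of a torus knot *)

Section ComplexNumbers.
Variable R : realType.
Implicit Types (z w : R * R) (r s a b m : R).

Definition cmul z w : R * R := (z.1 * w.1 - z.2 * w.2, z.1 * w.2 + z.2 * w.1).

Lemma sqnorm_cmul z w : sqnorm (cmul z w) = sqnorm z * sqnorm w.
Proof. by rewrite /sqnorm /=; ring. Qed.

Fixpoint cpow z (n : nat) : R * R := if n is m.+1 then cmul z (cpow z m) else (1, 0).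

Lemma cpowM z w n : cpow (cmul z w) n = cmul (cpow z n) (cpow w n).
Proof.
elim: n => [|n IHn] /=; first by rewrite /cmul /=; congr pair; ring.
by rewrite IHn /cmul /=; congr pair; ring.
Qed.

Lemma sqnorm_cpow z n : sqnorm (cpow z n) = sqnorm z ^+ n.
Proof.
elim: n => [|n IHn] /=; first by rewrite /sqnorm /= expr1n expr0n addr0.
by rewrite sqnorm_cmul IHn exprS.
Qed.

Lemma sqnorm_cis r a : sqnorm (cis r a) = r ^+ 2.
Proof. by rewrite /sqnorm /= !exprMn -mulrDr cos2Dsin2 mulr1. Qed.

Lemma cmul_cis r s a b : cmul (cis r a) (cis s b) = cis (r * s) (a + b).
Proof. by rewrite /cmul /cis /= cosD sinD; congr pair; ring. Qed.

Lemma cpow_cis r a n : cpow (cis r a) n = cis (r ^+ n) (n%:R * a).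
Proof.
elim: n => [|n IHn] /=; first by rewrite /cis mul0r cos0 sin0 mulr1 mulr0.
by rewrite IHn cmul_cis exprS -natr1 mulrDl mul1r [_ + a]addrC.
Qed.

Lemma scale_cis m r a : scale m (cis r a) = cis (m * r) a.
Proof. by rewrite /scale /cis /= !mulrA. Qed.

Lemma scale_cmul m z w : scale m (cmul z w) = cmul z (scale m w).
Proof. by rewrite /scale /cmul /=; congr pair; ring. Qed.

Lemma continuous_cmul (Y : topologicalType) (f g : Y -> R * R) :
  continuous f -> continuous g -> continuous (fun y => cmul (f y) (g y)).
Proof.
move=> cf cg y.
have f1 : {for y, continuous (fun x => (f x).1)}.
  exact: (continuous_compo cf (@fst_continuous _ _)).
have f2 : {for y, continuous (fun x => (f x).2)}.
  exact: (continuous_compo cf (@snd_continuous _ _)).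
have g1 : {for y, continuous (fun x => (g x).1)}.
  exact: (continuous_compo cg (@fst_continuous _ _)).
have g2 : {for y, continuous (fun x => (g x).2)}.
  exact: (continuous_compo cg (@snd_continuous _ _)).
suff : {for y, continuous (fun x => cmul (f x) (g x))} by [].
apply: continuous_at_pair; last by apply: continuous_atD; exact: continuous_atM.
have -> : (fun x => (f x).1 * (g x).1 - (f x).2 * (g x).2) =
    (fun x => (f x).1 * (g x).1 + (- 1) * ((f x).2 * (g x).2)).
  by apply/funext => x; rewrite mulN1r.
apply: continuous_atD; first exact: continuous_atM.
by apply: continuous_atM; [exact: cst_continuous|exact: continuous_atM].
Qed.

Lemma continuous_cpow (Y : topologicalType) (f : Y -> R * R) n :
  continuous f -> continuous (fun y => cpow (f y) n).
Proof.
move=> cf; elim: n => [|n IHn] /=; first exact: cst_continuous.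
exact: continuous_cmul.
Qed.

Lemma continuous_scale m : continuous (@scale R m).
Proof.
move=> y; suff : {for y, continuous (@scale R m)} by [].
apply: continuous_at_pair; apply: continuous_atM.
- exact: cst_continuous.
- exact: fst_continuous.
- exact: cst_continuous.
- exact: snd_continuous.
Qed.

(** The value at the zero vector, which the orbits of points off the knot avoid, is
    arbitrary. *)
Definition direction_val z : R * R :=
  if sqnorm z == 0 then cis 1 0 else scale (Num.sqrt (sqnorm z))^-1 z.

Lemma direction_subproof z : direction_val z \in [set v : R * R | sqnorm v = 1].
Proof.
rewrite inE /= /direction_val; case: eqP => [_|z0].
  by rewrite sqnorm_cis expr1n.
by rewrite sqnorm_scale exprVn sqr_sqrtr ?sqnorm_ge0 // mulVf //; exact/eqP.
Qed.

Definition direction z : sphere1 R :=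
  exist (fun v => v \in [set v : R * R | sqnorm v = 1]) _ (direction_subproof z).

Lemma direction_cis r a : 0 < r -> direction (cis r a) = circ a.
Proof.
move=> r0; apply: sphere1_eq.
rewrite circ_val -[LHS]/(direction_val (cis r a)) /direction_val sqnorm_cis.
rewrite sqrf_eq0 gt_eqF // sqrtr_sqr gtr0_norm // scale_cis mulVf ?gt_eqF //.
by rewrite /cis !mul1r.
Qed.

Lemma polar z : 0 < sqnorm z -> exists2 a, 0 < Num.sqrt (sqnorm z) &
  z = cis (Num.sqrt (sqnorm z)) a.
Proof.
move=> z0; have r0 : 0 < Num.sqrt (sqnorm z) by rewrite sqrtr_gt0.
have [a aE] := circ_surj (direction z); exists a => //.
have := congr1 set_val aE; rewrite circ_val -[RHS]/(direction_val z).
rewrite /direction_val gt_eqF // /scale => -[ca sa].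
by rewrite /cis ca sa !mulVKf ?gt_eqF //; case: (z).
Qed.

Lemma direction_cmul b z a : 0 < sqnorm z -> direction z = circ a ->
  direction (cmul (cis 1 b) z) = circ (b + a).
Proof.
move=> /polar[a']; move: (Num.sqrt _) => r r0 ->.
rewrite cmul_cis !direction_cis ?mul1r // => a'a.
by rewrite addrC [b + a]addrC; exact: circD.
Qed.

Lemma continuous_direction (Y : topologicalType) (f : Y -> R * R) :
  continuous f -> (forall y, 0 < sqnorm (f y)) -> continuous (fun y => direction (f y)).
Proof.
move=> cf f0; apply: continuous_into_sphere1 => y.
have -> : (fun y => set_val (direction (f y))) =
    (fun y => scale (Num.sqrt (sqnorm (f y)))^-1 (f y)).
  apply/funext => x; rewrite -[LHS]/(direction_val (f x)) /direction_val.
  by rewrite gt_eqF.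
have cn : {for y, continuous (fun y => (Num.sqrt (sqnorm (f y)))^-1)}.
  apply: continuous_atV; last by rewrite gt_eqF // sqrtr_gt0.
  apply: (continuous_compo _ (@sqrt_continuous R)).
  exact: (continuous_compo cf (@continuous_sqnorm R)).
suff : {for y, continuous (fun y => scale (Num.sqrt (sqnorm (f y)))^-1 (f y))} by [].
apply: continuous_at_pair; apply: continuous_atM.
- exact: cn.
- exact: (continuous_compo cf (@fst_continuous _ _)).
- exact: cn.
- exact: (continuous_compo cf (@snd_continuous _ _)).
Qed.

End ComplexNumbers.

Section TorusKnot.
Variables (R : realType) (p q : nat).
Implicit Types x : sphere3 R.

Lemma circ_mulrn d n : circ d = circ 0 :> sphere1 R -> circ (n%:R * d) = circ 0.
Proof.
move=> d0; elim: n => [|n IHn]; first by rewrite mul0r.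
by rewrite -natr1 mulrDl mul1r circ_period.
Qed.

Lemma cis_circ r a b : circ a = circ b :> sphere1 R -> cis r a = cis r b.
Proof. by move=> /circ_eq[ca sa]; rewrite /cis ca sa. Qed.

Lemma circ_cis a b : cis 1 a = cis 1 b -> circ a = circ b :> sphere1 R.
Proof. by move=> ab; apply: sphere1_eq; exact: ab. Qed.

Definition csub (z w : R * R) : R * R := (z.1 - w.1, z.2 - w.2).

(** The polynomial whose link at the origin is the torus knot, rescaled so that
    its zeros in the unit sphere are exactly the points of the knot. *)
Definition knot_fun x : R * R :=
  csub (cpow (scale (Num.sqrt 2) (set_val x).1) q)
       (cpow (scale (Num.sqrt 2) (set_val x).2) p).

Lemma sphere3P x : sqnorm (set_val x).1 + sqnorm (set_val x).2 = 1.
Proof. by have := valP x; rewrite inE. Qed.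

Let sqrt2_gt0 : 0 < Num.sqrt 2 :> R. Proof. by rewrite sqrtr_gt0. Qed.

Lemma knot_fun_standard x : standard_torus_knot p q x -> knot_fun x = (0, 0).
Proof.
move=> [a xE]; rewrite /knot_fun xE /= !scale_cis mulfV ?gt_eqF //.
rewrite !cpow_cis !expr1n /csub.
have -> : q%:R * (p%:R * a) = p%:R * (q%:R * a) by ring.
by rewrite !subrr.
Qed.

Let expr_eq_both_1 (a b : R) : (0 < p)%N -> (0 < q)%N -> 0 <= a -> 0 <= b ->
  a + b = 2 -> a ^+ q = b ^+ p -> a = 1.
Proof.
move=> p0 q0 a0 b0 ab abE; have [a1|a1|//] := ltgtP a 1.
  have : a ^+ q < 1 by rewrite exprn_ilt1 // -lt0n.
  have b1 : 1 < b by lra.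
  by rewrite abE ltNge ltW // exprn_egt1 // -lt0n.
have b1 : b < 1 by lra.
have : b ^+ p < 1 by rewrite exprn_ilt1 // -lt0n.
by rewrite -abE ltNge ltW // exprn_egt1 // -lt0n.
Qed.

(** At a zero both coordinates have the same norm, and Bezout coefficients of
    [p] and [q] recover the parameter from the arguments of the coordinates. *)
Lemma knot_fun_eq0 x : (0 < p)%N -> (0 < q)%N -> coprime p q ->
  knot_fun x = (0, 0) -> standard_torus_knot p q x.
Proof.
move=> p0 q0 pq; have := sphere3P x; rewrite /knot_fun /standard_torus_knot /=.
case: (set_val x) => z w /= zw1.
set Z := scale _ z; set W := scale _ w.
case; move=> /eqP; rewrite subr_eq0 => /eqP e1 /eqP; rewrite subr_eq0 => /eqP e2.
have ZW : cpow Z q = cpow W p by case: (cpow Z q) (cpow W p) e1 e2 => [? ?] [? ?] /= -> ->.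
have nZ : sqnorm Z = 2 * sqnorm z by rewrite sqnorm_scale sqr_sqrtr.
have nW : sqnorm W = 2 * sqnorm w by rewrite sqnorm_scale sqr_sqrtr.
have nZW : sqnorm Z ^+ q = sqnorm W ^+ p by rewrite -!sqnorm_cpow ZW.
have Z1 : sqnorm Z = 1.
  apply: (expr_eq_both_1 p0 q0 _ _ _ nZW); rewrite ?sqnorm_ge0 //; lra.
have W1 : sqnorm W = 1 by lra.
have [al _ ZE] : exists2 a, 0 < Num.sqrt (sqnorm Z) & Z = cis (Num.sqrt (sqnorm Z)) a.
  by apply: polar; rewrite Z1.
have [be _ WE] : exists2 a, 0 < Num.sqrt (sqnorm W) & W = cis (Num.sqrt (sqnorm W)) a.
  by apply: polar; rewrite W1.
rewrite Z1 sqrtr1 in ZE; rewrite W1 sqrtr1 in WE.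
have dE : circ (q%:R * al - p%:R * be) = circ 0 :> sphere1 R.
  by apply/circ_sub/circ_cis; move: ZW; rewrite ZE WE !cpow_cis !expr1n.
have [u v uvE _] := egcdnP q p0; rewrite (eqP pq) in uvE.
have {}uvE : u%:R * p%:R = v%:R * q%:R + 1 :> R by rewrite -!natrM uvE natrD.
exists (u%:R * al - v%:R * be).
have unscale y Y : Y = scale (Num.sqrt 2) y -> y = scale (Num.sqrt 2)^-1 Y :> R * R.
  by move=> ->; rewrite /scale /= !mulKf ?gt_eqF //; case: y.
congr pair.
- rewrite (unscale z Z) // ZE scale_cis mulr1; apply: cis_circ.
  rewrite -(circ_period al (circ_mulrn v dE)); congr circ.
  have -> : p%:R * (u%:R * al - v%:R * be) = (u%:R * p%:R) * al - v%:R * (p%:R * be) by ring.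
  by rewrite uvE; ring.
- rewrite (unscale w W) // WE scale_cis mulr1; apply: cis_circ.
  rewrite -(circ_period be (circ_mulrn u dE)); congr circ.
  have -> : q%:R * (u%:R * al - v%:R * be) =
      u%:R * (q%:R * al) - (v%:R * q%:R + 1) * be + be by ring.
  by rewrite -uvE; ring.
Qed.

Lemma continuous_sphere3_val : continuous (set_val : sphere3 R -> (R * R) * (R * R)).
Proof. exact: initial_continuous. Qed.

Lemma continuous_knot_fun : continuous knot_fun.
Proof.
have c1 : continuous (fun x => cpow (scale (Num.sqrt 2) (set_val x).1) q).
  apply: continuous_cpow; apply: (continuous_compo _ (@continuous_scale R _)).
  exact: (continuous_compo continuous_sphere3_val (@fst_continuous _ _)).
have c2 : continuous (fun x => cpow (scale (Num.sqrt 2) (set_val x).2) p).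
  apply: continuous_cpow; apply: (continuous_compo _ (@continuous_scale R _)).
  exact: (continuous_compo continuous_sphere3_val (@snd_continuous _ _)).
apply: continuous_pair; apply: continuous_subr.
- exact: (continuous_compo c1 (@fst_continuous _ _)).
- exact: (continuous_compo c2 (@fst_continuous _ _)).
- exact: (continuous_compo c1 (@snd_continuous _ _)).
- exact: (continuous_compo c2 (@snd_continuous _ _)).
Qed.

(** The angle of [n] turns per unit of time. *)
Definition turn (n : nat) (t : R) : R := n%:R * (pi *+ 2) * t.

Lemma rotation_subproof (t : R) x :
  (cmul (cis 1 (turn p t)) (set_val x).1, cmul (cis 1 (turn q t)) (set_val x).2) \in
  [set x : (R * R) * (R * R) | sqnorm x.1 + sqnorm x.2 = 1].
Proof. by rewrite inE /= !sqnorm_cmul !sqnorm_cis expr1n !mul1r sphere3P. Qed.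

Definition rotation (t : R) x : sphere3 R :=
  exist (fun z => z \in [set x : (R * R) * (R * R) | sqnorm x.1 + sqnorm x.2 = 1])
    _ (rotation_subproof t x).

Lemma rotation_trivial t x : circ (turn p t) = circ 0 :> sphere1 R ->
  circ (turn q t) = circ 0 :> sphere1 R -> rotation t x = x.
Proof.
move=> pt qt; apply: (@val_inj _ _ (sphere3 R)).
rewrite -[RHS]/(set_val x) -[LHS]/(cmul _ (set_val x).1, cmul _ (set_val x).2).
rewrite (cis_circ 1 pt) (cis_circ 1 qt).
have one z : cmul (cis 1 0) z = z :> R * R.
  by rewrite /cmul /cis /= cos0 sin0; case: z => a b /=; congr pair; ring.
by rewrite !one; case: (set_val x).
Qed.

Lemma rotation0 x : rotation 0 x = x.
Proof. by apply: rotation_trivial; rewrite /turn mulr0. Qed.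

Lemma rotation1 x : rotation 1 x = x.
Proof.
have t0 : circ (pi *+ 2) = circ 0 :> sphere1 R.
  by apply/circ_eq; rewrite cos2pi sin2pi cos0 sin0.
by apply: rotation_trivial; rewrite /turn mulr1 circ_mulrn.
Qed.

Lemma knot_fun_rotation t x :
  knot_fun (rotation t x) = cmul (cis 1 (turn (p * q) t)) (knot_fun x).
Proof.
rewrite /knot_fun /= !scale_cmul !cpowM !cpow_cis !expr1n.
have -> : q%:R * turn p t = turn (p * q) t by rewrite /turn natrM; ring.
have -> : p%:R * turn q t = turn (p * q) t by rewrite /turn natrM; ring.
by rewrite /csub /cmul /=; congr pair; ring.
Qed.

Lemma continuous_rotation (Y : topologicalType) (t : Y -> R) (c : Y -> sphere3 R) :
  continuous t -> continuous c -> continuous (fun y => rotation (t y) (c y)).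
Proof.
move=> ct cc; apply: continuous_comp_initial.
have cturn n : continuous (fun y => cis 1 (turn n (t y))).
  have cn : continuous (fun y => turn n (t y)).
    move=> y; apply: cvgM; [exact: cst_continuous|exact: ct].
  apply: (continuous_compo cn) => a.
  suff : {for a, continuous (fun b : R => cis 1 b)} by [].
  apply: continuous_at_pair; apply: continuous_atM; try exact: cst_continuous.
    exact: continuous_cos.
  exact: continuous_sin.
have cval : continuous (fun y => set_val (c y)).
  exact: (continuous_compo cc continuous_sphere3_val).
apply: continuous_pair; apply: continuous_cmul => //.
- exact: (continuous_compo cval (@fst_continuous _ _)).
- exact: (continuous_compo cval (@snd_continuous _ _)).
Qed.

End TorusKnot.

(** * The circle action on the exterior *)

Section TorusKnotExterior.
Variables (R : realType) (tau : sphere1 R * (R * R) -> sphere3 R).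
Local Notation I := (unit_interval R).
Local Notation X := (set_type (exterior tau)).
Local Notation k := (tau @` [set y | y.2 = (0, 0)]).
Hypotheses (ctau : continuous tau) (tauI : injective tau).
Hypothesis tau_open : forall O, open O -> open (tau @` O).
Variables (p q : nat).
Hypotheses (p_gt0 : (0 < p)%N) (q_gt0 : (0 < q)%N) (co_pq : coprime p q).
Variables (h h' : sphere3 R -> sphere3 R).
Hypotheses (ch : continuous h) (ch' : continuous h').
Hypotheses (hK : cancel h h') (h'K : cancel h' h).
Hypothesis kE : k = h @` standard_torus_knot p q.

Lemma off_knot z : ~ k z -> 0 < sqnorm (knot_fun p q (h' z)).
Proof.
move=> kz; apply: sqnorm_gt0 => /(knot_fun_eq0 p_gt0 q_gt0 co_pq) sz.
by apply: kz; rewrite kE; exists (h' z).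
Qed.

Lemma off_knot_rotation t z : ~ k z -> ~ k (h (rotation p q t (h' z))).
Proof.
move=> kz; rewrite kE => -[y /knot_fun_standard y0 /(can_inj hK) yE].
have := off_knot kz; rewrite ltNge; move/negP; apply.
have : sqnorm (knot_fun p q (rotation p q t (h' z))) = 0.
  by rewrite -yE y0 /sqnorm /= expr0n /= addr0.
by rewrite knot_fun_rotation sqnorm_cmul sqnorm_cis expr1n mul1r => ->.
Qed.

Lemma exterior_off_knot (x : X) : ~ k (set_val x).
Proof.
have := valP x; rewrite inE => xE [y /= y0 yE]; apply: xE.
by exists y => //=; rewrite y0 /sqnorm /= expr0n /= addr0 ltr01.
Qed.

Lemma exterior_action_subproof (z : X * I) :
  retract tau 1 (h (rotation p q (ui_val z.2) (h' (set_val z.1)))) \in exterior tau.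
Proof.
by rewrite inE; apply: retract1 => //; apply: off_knot_rotation; exact: exterior_off_knot.
Qed.

(** The orbit of a point of the exterior under the circle action, conjugated by the
    homeomorphism [h] onto the given knot and pushed back into the exterior. *)
Definition exterior_action (z : X * I) : X :=
  exist (fun y => y \in exterior tau) _ (exterior_action_subproof z).

Let continuous_exterior_val : continuous (set_val : X -> sphere3 R).
Proof. exact: initial_continuous. Qed.

Let continuous_moved (Y : topologicalType) (t : Y -> R) (c : Y -> X) :
  continuous t -> continuous c ->
  continuous (fun y => h (rotation p q (t y) (h' (set_val (c y))))).
Proof.
move=> ct cc; apply: (continuous_compo _ ch); apply: continuous_rotation => //.
exact: (continuous_compo (continuous_compo cc continuous_exterior_val) ch').
Qed.

Lemma continuous_exterior_action : continuous exterior_action.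
Proof.
apply: continuous_comp_initial.
apply: (@continuous_retract _ _ ctau tauI tau_open (X * I)%type (cst 1)
  (fun z => h (rotation p q (ui_val z.2) (h' (set_val z.1))))).
- exact: cst_continuous.
- apply: continuous_moved; last exact: fst_continuous.
  exact: (continuous_compo (@snd_continuous _ _) (@ui_val_continuous R)).
- by move=> z; apply: off_knot_rotation; exact: exterior_off_knot.
Qed.

Let exterior_retract (x : X) : retract tau 1 (set_val x) = set_val x.
Proof. by apply: retract_exterior => //; have := valP x; rewrite inE. Qed.

Lemma exterior_action0 x : exterior_action (x, zero) = x.
Proof.
apply: (@val_inj _ _ X); rewrite -[LHS]/(retract tau 1 (h (rotation p q (ui_val zero) (h' (set_val x))))).
by rewrite ui_zero rotation0 h'K exterior_retract.
Qed.

Lemma exterior_action1 x : exterior_action (x, one) = x.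
Proof.
apply: (@val_inj _ _ X); rewrite -[LHS]/(retract tau 1 (h (rotation p q (ui_val one) (h' (set_val x))))).
by rewrite ui_one rotation1 h'K exterior_retract.
Qed.

Definition knot_angle (x : X) : sphere1 R :=
  direction (knot_fun p q (h' (set_val x))).

Lemma continuous_knot_angle : continuous knot_angle.
Proof.
apply: continuous_direction; last by move=> x; apply: off_knot; exact: exterior_off_knot.
apply: (continuous_compo _ (@continuous_knot_fun R p q)).
exact: (continuous_compo continuous_exterior_val ch').
Qed.

(** Undoing the retraction deforms the orbit of [x] to an orbit of the circle
    action on the sphere, along which the argument grows at constant speed. *)
Lemma winding_exterior_action x :
  winding (fun t : I => knot_angle (exterior_action (x, t))) (turn (p * q) (1 : R)).
Proof.
pose c (z : I * I) := h (rotation p q (ui_val z.1) (h' (set_val x))).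
have ck z : ~ k (c z) by apply: off_knot_rotation; exact: exterior_off_knot.
pose F (z : I * I) := direction (knot_fun p q (h' (retract tau (ui_val z.2) (c z)))).
have rk z : ~ k (retract tau (ui_val z.2) (c z)).
  by apply: retract_avoids => //; have /andP[] := ui_valP z.2.
have cF : continuous F.
  apply: continuous_direction; last by move=> z; apply: off_knot.
  apply: (continuous_compo _ (@continuous_knot_fun R p q)).
  apply: (continuous_compo _ ch'); apply: continuous_retract => //.
    exact: (continuous_compo (@snd_continuous _ _) (@ui_val_continuous R)).
  apply: (@continuous_moved _ (fun z : I * I => ui_val z.1) (cst x)).
    exact: (continuous_compo (@fst_continuous _ _) (@ui_val_continuous R)).
  exact: cst_continuous.
have -> : (fun t : I => knot_angle (exterior_action (x, t))) = (fun t => F (t, one)).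
  by apply/funext => t; rewrite /F /= ui_one.
apply: (winding_homotopy cF).
  by move=> t; rewrite /F /c /= ui_zero ui_one rotation0 rotation1.
have [a aE] := circ_surj (direction (knot_fun p q (h' (set_val x)))).
exists (fun t : I => turn (p * q) (ui_val t) + a); split.
- apply: continuous_addr; last exact: cst_continuous.
  apply: (continuous_compo (@ui_val_continuous R)) => t.
  by apply: cvgM; [exact: cst_continuous|exact: cvg_id].
- move=> t; rewrite /F /c /= ui_zero (retract0 tauI) hK knot_fun_rotation.
  by rewrite (direction_cmul _ _ (esym aE)) //; apply: off_knot; exact: exterior_off_knot.
- by rewrite ui_one ui_zero /turn mulr0; ring.
Qed.

(** The winding number of the orbit is [p * q] full turns, which is not zero. *)
Lemma orbit_not_commutator x : ~ commutator_subgroup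
  (loop_class (trace continuous_exterior_action exterior_action0 exterior_action1 x)).
Proof.
set l := trace _ _ _ _ => /(winding_number_commutator continuous_knot_angle).
have wl := winding_number_class continuous_knot_angle l.
have -> := winding_unique wl (winding_exterior_action x).
have t0 : 0 < turn (p * q) (1 : R).
  by rewrite /turn mulr1 mulr_gt0 ?ltr0n ?muln_gt0 ?p_gt0 // mulrn_wgt0 // pi_gt0.
by move=> t1; rewrite t1 ltxx in t0.
Qed.

End TorusKnotExterior.

Theorem corollary7p4 (R : realType) (k : set (sphere3 R))
    (tau : sphere1 R * (R * R) -> sphere3 R)
    (E : topologicalType) (p : E -> set_type (exterior tau)) (e0 : E)
    (eps : pi1 R (p e0) -> int) (N : nat)
    (gamma : pi1 R (p e0) -> 'M[int]_N) (Delta : laurent) :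
  torus_knot k ->
  tubular_neighbourhood k tau ->
  universal_cover R p ->
  abelianization_int eps ->
  permutation_representation gamma ->
  twisted_alexander_polynomial eps gamma Delta ->
  exists (b : bool) (i : int) (s : seq nat),
    all (leq 1) s /\
    Delta = (-1) ^+ b * tpow i * laurent_of_poly (\prod_(n <- s) 'Phi_n).
Proof.
move=> [a [b [a0 b0 ab [h [[ch [h' [ch' hK h'K]]] kE]]]]].
move=> [ctau tauI tau_open tauk] [covp _] [_ _ epsP] [_ _ gammaP].
move=> [m [n [A [presA gcdA]]]].
rewrite -{}tauk in kE.
pose cH := @continuous_exterior_action R tau ctau tauI tau_open a b a0 b0 ab
  h h' ch ch' hK h'K kE.
have [r r0 rP] := @identity_homotopy_annihilates R E _ p e0 eps N gamma _ cH
  (exterior_action0 tauI a0 b0 ab hK h'K kE)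
  (exterior_action1 tauI a0 b0 ab hK h'K kE) covp gammaP.
have [c cE] := gcd_minors_dvd_annihilator presA rP gcdA.
apply: laurent_dvd_tpow_int_sub_1 cE.
rewrite mulf_neq0 //; first by rewrite -lt0n.
apply/eqP => /epsP.
exact: orbit_not_commutator.
Qed.
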